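(* There exists a rigid arrangement $\mathcal{O}_{33}$ of $33$ lines defined over the real numbers (i.e. in the real projective plane) such that $$n_{2} = 108, \quad n_{3} = 40, \quad n_{5} = 16, \quad n_{8}=5,$$ and all other $n_k$ vanish. The arrangement $\mathcal{O}_{33}$ (viewed as a complex plane curve) is free with exponents $(d_{1},d_{2}) = (15,17)$.
   Context: For a line arrangement $\mathcal{L}$ and $k\ge 2$, $n_k$ denotes the number of points where exactly $k$ lines of $\mathcal{L}$ meet. A line arrangement is rigid if its realization space (the moduli space of line arrangements with the same intersection lattice, i.e. the same incidences between lines and intersection points, up to the action of $\mathrm{PGL}_3$) is zero-dimensional. Let $S=\mathbb{C}[x,y,z]$ and let $C: f=0$ be a reduced plane curve of degree $d$, with Jacobian ideal $J_f=\langle \partial_x f,\partial_y f,\partial_z f\rangle$ and Milnor algebra $M(f)=S/J_f$. The curve $C$ is free with exponents $(d_1,d_2)$, $d_1\le d_2$, if $M(f)$ has a minimal graded free resolution of the form $0\to S(1-d-d_1)\oplus S(1-d-d_2)\to S^3(1-d)\to S\to M(f)\to 0$; then $d_1+d_2=d-1$. *)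

(* Defs.v *)
From HB Require Import structures.
From mathcomp Require Import all_boot all_order all_algebra.
From mathcomp Require Import Rstruct complex.
From mathcomp Require Import mpoly.

Set Implicit Arguments.
Unset Strict Implicit.
Unset Printing Implicit Defensive.

Import GRing.Theory.
Local Open Scope ring_scope.

(* A (labelled) line arrangement of n lines in P^2(K): line i is
   { [x:y:z] | a x + b y + c z = 0 } where (a,b,c) = L i. *)
Definition arrangement (K : fieldType) (n : nat) := {ffun 'I_n -> 'rV[K]_3}.

Definition is_arrangement (K : fieldType) (n : nat) (L : arrangement K n) : Prop :=
  (forall i, L i != 0) /\ (forall i j (c : K), i != j -> L i != c *: L j).

Definition on_line (K : fieldType) (n : nat) (L : arrangement K n) (i : 'I_n)
    (p : 'rV[K]_3) : bool :=
  \sum_(k < 3) L i 0 k * p 0 k == 0.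

Definition lines_through (K : fieldType) (n : nat) (L : arrangement K n)
    (p : 'rV[K]_3) : {set 'I_n} :=
  [set i | on_line L i p].

(* [nk_eq L k m] : the number n_k of points of P^2(K) lying on exactly k lines
   of L equals m.  For k >= 2 a point is determined by the set of lines through
   it, so points of multiplicity k are counted via their sets of lines. *)
Definition nk_eq (K : fieldType) (n : nat) (L : arrangement K n) (k m : nat) : Prop :=
  exists s : seq {set 'I_n},
    [/\ uniq s, size s = m &
        forall S, S \in s <-> (#|S| = k /\ exists p : 'rV[K]_3, p != 0 /\ lines_through L p = S)].

Definition concurrent (K : fieldType) (n : nat) (L : arrangement K n) (S : {set 'I_n}) : Prop :=
  exists p : 'rV[K]_3, p != 0 /\ forall i, i \in S -> on_line L i p.

Definition same_lattice (K : fieldType) (n : nat) (L M : arrangement K n) : Prop :=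
  forall S : {set 'I_n}, concurrent L S <-> concurrent M S.

Definition proj_equiv (K : fieldType) (n : nat) (L M : arrangement K n) : Prop :=
  exists g : 'M[K]_3, g \in unitmx /\
    exists c : 'I_n -> K, (forall i, c i != 0) /\ forall i, M i = c i *: (L i *m g).

(* rigid: the realization space (arrangements over K with the same intersection
   lattice, modulo PGL_3(K)) is zero-dimensional, i.e. finite (it is nonempty
   since it contains L). *)
Definition rigid (K : fieldType) (n : nat) (L : arrangement K n) : Prop :=
  exists s : seq (arrangement K n),
    forall M : arrangement K n, is_arrangement M -> same_lattice L M ->
      exists2 M0, M0 \in s & proj_equiv M0 M.

Definition linear_form (K : fieldType) (v : 'rV[K]_3) : {mpoly K[3]} :=
  \sum_(k < 3) (v 0 k)%:MP * 'X_k.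

Definition defining_poly (K : fieldType) (n : nat) (L : arrangement K n) : {mpoly K[3]} :=
  \prod_(i < n) linear_form (L i).

Definition jac_syzygy (K : fieldType) (f : {mpoly K[3]}) (a : 'I_3 -> {mpoly K[3]}) : Prop :=
  \sum_(k < 3) a k * mderiv k f = 0.

(* C : f = 0 is free with exponents (d1,d2): M(f) = S/J_f has a minimal graded
   free resolution  0 -> S(1-d-d1) (+) S(1-d-d2) -> S^3(1-d) -> S -> M(f) -> 0,
   the map S^3(1-d) -> S being (f_x, f_y, f_z).  Unfolded: there are homogeneous
   syzygies r1, r2 of degrees d1, d2 (the columns of the graded degree-0 map
   S(1-d-d1) (+) S(1-d-d2) -> S^3(1-d)) such that this map is injective and its
   image is the kernel of (f_x,f_y,f_z). *)
Definition free_with_exponents (K : fieldType) (f : {mpoly K[3]}) (d1 d2 : nat) : Prop :=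
  (d1 <= d2)%N /\
  exists r1 r2 : 'I_3 -> {mpoly K[3]},
    [/\ (forall k, r1 k \is d1.-homog), (forall k, r2 k \is d2.-homog),
        (forall a : 'I_3 -> {mpoly K[3]},
           jac_syzygy f a <-> exists p q : {mpoly K[3]}, forall k, a k = p * r1 k + q * r2 k) &
        (forall p q : {mpoly K[3]}, (forall k, p * r1 k + q * r2 k = 0) -> p = 0 /\ q = 0)].

Definition RR := Rdefinitions.R.
Definition CC := complex RR.

Definition complexify (n : nat) (L : arrangement RR n) : arrangement CC n :=
  [ffun i => map_mx (fun x : RR => Complex x 0) (L i)].

(* Main.v *)
Require Import Defs.
From HB Require Import structures.
From Stdlib Require Import BinInt.
From mathcomp Require Import all_boot all_order all_algebra.
From mathcomp Require Import Rstruct complex.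
From mathcomp Require Import mpoly.
From mathcomp Require Import ring ssrZ zify.

(* The arrangement has the symmetry of the regular octagon: the line at infinity,
   the 8 mirrors of the octagon, and in each of the 4 directions of its sides
   three pairs of lines at distances s^-1, 1 and s from the centre, with
   s = 1 + sqrt 2.  The 8-fold points are the centre and 4 points at infinity.
   In suitable coordinates all 33 lines have coefficients in Z[sqrt 2], where
   the incidences can be computed.

   Rigidity: the sides x +- y = +- 1 of a square form a projective frame; they
   determine the line at infinity, the axes and the diagonals.  A line x = c has
   one free parameter, and a single 5-fold point forces 2 c^2 = 1; all other lines
   are then joins of constructed points.  So the realizations are the
   arrangement and its Galois conjugate.

   Freeness: by Saito's criterion, it suffices to give vector fields of degrees
   15 and 17 tangent to all the lines and independent modulo the Euler field.
   They have the form P(x, y, z) d/dx + P(y, x, z) d/dy, with P divisible by the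
   lines of direction x = 0. *)

Set Implicit Arguments.
Unset Strict Implicit.
Unset Printing Implicit Defensive.

Import GRing.Theory Num.Theory.
Local Open Scope ring_scope.

(** * Saito's criterion *)

Definition o0 : 'I_3 := @Ordinal 3 0 isT.
Definition o1 : 'I_3 := @Ordinal 3 1 isT.
Definition o2 : 'I_3 := @Ordinal 3 2 isT.

Lemma forall_ord3 (P : 'I_3 -> Prop) : P o0 -> P o1 -> P o2 -> forall i, P i.
Proof.
move=> P0 P1 P2 [[|[|[|//]]] lti].
- by rewrite (_ : Ordinal lti = o0) //; apply: val_inj.
- by rewrite (_ : Ordinal lti = o1) //; apply: val_inj.
- by rewrite (_ : Ordinal lti = o2) //; apply: val_inj.
Qed.

Lemma sum_ord3 (V : nmodType) (F : 'I_3 -> V) :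
  \sum_(k < 3) F k = F o0 + F o1 + F o2.
Proof.
rewrite !big_ord_recl big_ord0 addr0 addrA.
by congr (F _ + F _ + F _); apply: val_inj.
Qed.

(** * Determinants and cross products of triples *)

Section Determinant.
Variable R : comNzRingType.
Implicit Types a b c : 'I_3 -> R.

Definition det3 a b c : R :=
  a o0 * (b o1 * c o2 - b o2 * c o1) - a o1 * (b o0 * c o2 - b o2 * c o0)
  + a o2 * (b o0 * c o1 - b o1 * c o0).

Definition dot a b : R := \sum_(k < 3) a k * b k.

Definition cross a b (k : 'I_3) : R :=
  match val k with
  | 0 => a o1 * b o2 - a o2 * b o1
  | 1 => a o2 * b o0 - a o0 * b o2
  | _ => a o0 * b o1 - a o1 * b o0
  end.

Lemma det3_dot a b c : det3 a b c = dot c (cross a b).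
Proof. by rewrite /dot sum_ord3 /det3 /cross /=; ring. Qed.

(** Cramer's rule recovers [u] from its pairings with three vectors, so a common divisor of the
    pairings divides [u k * det3 a b c]. *)
Lemma cramer3 a b c u (k : 'I_3) :
  u k * det3 a b c =
    dot a u * cross b c k + dot b u * cross c a k + dot c u * cross a b k.
Proof.
by move: k; apply: forall_ord3; rewrite /dot !sum_ord3 /det3 /cross /=; ring.
Qed.

(** The linear relation among four vectors; it serves both Saito's criterion and the fourth line of
    a projective frame. *)
Lemma cramer3r a b c d (k : 'I_3) :
  det3 a b c * d k = det3 d b c * a k + det3 a d c * b k + det3 a b d * c k.
Proof. by move: k; apply: forall_ord3; rewrite /det3; ring. Qed.

Lemma det3_comb p q a b c k : (forall i, p * a i + q * b i = k i) ->
  p * det3 a b c = det3 k b c /\ q * det3 a b c = det3 a k c.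
Proof. by move=> e; rewrite /det3 -!e; split; ring. Qed.

End Determinant.

(** * Divisibility by linear forms *)

Section Saito.
Variable K : numFieldType.
Local Notation mp := {mpoly K[3]}.
Implicit Types (u v : 'rV[K]_3) (p q : mp) (a b : 'I_3 -> mp).

Definition coords u : 'I_3 -> mp := fun k => (u 0 k)%:MP.
Definition coordX : 'I_3 -> mp := fun k => 'X_k.

Definition mdvd p q : Prop := exists g, q = g * p.

Lemma mdvd_mull p q g : mdvd p q -> mdvd p (g * q).
Proof. by move=> [h ->]; exists (g * h); rewrite mulrA. Qed.

Lemma mdvd_add p q r : mdvd p q -> mdvd p r -> mdvd p (q + r).
Proof. by move=> [h ->] [g ->]; exists (h + g); rewrite mulrDl. Qed.

Lemma linear_form_dot u : linear_form u = dot coordX (coords u).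
Proof. by apply: eq_bigr => k _; rewrite mulrC. Qed.

Lemma mderiv_linear_form u k : mderiv k (linear_form u) = (u 0 k)%:MP.
Proof.
rewrite /linear_form raddf_sum (bigD1 k) //= big1 => [|i ik].
  rewrite mderiv_mulC mderivX mnm1E eqxx scale1r addr0.
  rewrite (_ : (U_(k) - U_(k))%MM = 0%MM) ?mpolyX0 ?mulr1 //.
  by apply/mnmP=> i; rewrite mnmBE subnn mnm0E.
by rewrite mderiv_mulC mderivX mnm1E (negbTE ik) scale0r mulr0.
Qed.

Lemma linear_form_eq0 u : linear_form u = 0 -> u = 0.
Proof.
move=> u0; apply/rowP=> k; rewrite mxE; have := mderiv_linear_form u k.
by rewrite u0 mderiv0 => /esym/eqP; rewrite mpolyC_eq0 => /eqP.
Qed.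

Lemma linear_formBZ u v (c : K) :
  linear_form (u - c *: v) = linear_form u - c%:MP * linear_form v.
Proof.
rewrite /linear_form mulr_sumr -sumrB; apply: eq_bigr => k _.
by rewrite !mxE raddfB /= mpolyCM; ring.
Qed.

Lemma linear_form_homog u : linear_form u \is 1.-homog.
Proof.
apply: rpred_sum => k _; rewrite mul_mpolyC; apply: rpredZ.
by rewrite dhomogX /= mdeg1.
Qed.

(* For [dot u v = 1], substituting [X - (u . X) v] for [X] is the projection of
   K^3 onto the plane [u = 0] along [v]; its kernel is the ideal of the linear
   form [u], which is therefore prime. *)
Definition proj_form u v : 3.-tuple mp :=
  [tuple 'X_k - (v 0 k)%:MP * linear_form u | k < 3].

Definition restrict u v (p : mp) : mp := p \mPo proj_form u v.

Lemma restrictX u v k :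
  restrict u v 'X_k = 'X_k - (v 0 k)%:MP * linear_form u.
Proof.
rewrite /restrict comp_mpolyXU -tnth_nth.
by rewrite tnth_mktuple.
Qed.

Lemma restrict_linear_form u v w : restrict u v (linear_form w) =
  linear_form w - (\sum_k w 0 k * v 0 k)%:MP * linear_form u.
Proof.
rewrite {1}/linear_form /restrict raddf_sum /=.
under eq_bigr => k _ do
  rewrite rmorphM /= comp_mpolyC -/(restrict u v _) restrictX mulrBr mulrA -mpolyCM.
by rewrite sumrB -mulr_suml -raddf_sum.
Qed.

(** Degree [d - 1], for quotients by a linear form; degree [-1] leaves only zero. *)
Definition homog_pred (d : nat) (q : mp) : Prop :=
  if d is d'.+1 then q \is d'.-homog else q = 0.

(** Induction on the degree, multiplying by one variable at a time and keeping the quotient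
    homogeneous. *)
Lemma restrict_mon u v (m : 'X_{1..3}) : exists2 q : mp,
  'X_[m] - restrict u v 'X_[m] = q * linear_form u & homog_pred (mdeg m) q.
Proof.
pose good d (p : mp) := restrict u v p \is d.-homog /\
  exists2 q : mp, p - restrict u v p = q * linear_form u & homog_pred d q.
have good1 : good 0 1.
  rewrite /good /restrict rmorph1; split; first exact: dhomog1.
  by exists 0; rewrite ?subrr ?mul0r ?rpred0.
have goodX k d p : p \is d.-homog -> good d p -> good d.+1 ('X_k * p).
  move=> homp [hp [q eq hq]]; rewrite /good /restrict rmorphM /= -!/(restrict u v _).
  have hX : restrict u v 'X_k \is 1.-homog.
    rewrite restrictX; apply: rpredB; first by rewrite dhomogX /= mdeg1.
    by rewrite mul_mpolyC rpredZ ?linear_form_homog.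
  split; first exact: (dhomogM hX hp).
  (* With primes for restrictions, [X p - X' p' = (X - X') p + X' (p - p')]. *)
  exists ((v 0 k)%:MP * p + restrict u v 'X_k * q).
    by rewrite mulrDl -[restrict u v 'X_k * q * _]mulrA -eq !restrictX; ring.
  apply: rpredD; first by rewrite mul_mpolyC rpredZ.
  by case: d hq {hp homp} => [->|d hq]; [rewrite mulr0 rpred0 | exact: (dhomogM hX hq)].
suff [_ //] : good (mdeg m) 'X_[m].
move: {2}(mdeg m) (erefl (mdeg m)) => d; elim: d m => [|d IH] m dm.
  have /eqP -> : m == 0%MM by rewrite -mdeg_eq0 dm.
  by rewrite mdeg0 mpolyX0.
have [k mk] : exists k, (0 < m k)%N.
  apply/existsP; rewrite -[[exists _, _]]negbK; apply/negP => /existsPn m0.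
  by move: dm; rewrite mdegE big1 // => i _; apply/eqP; rewrite -leqn0 leqNgt m0.
have em : m = (U_(k) + (m - U_(k)))%MM.
  by rewrite addmC submK //; apply/mnm_lepP => i; rewrite mnm1E; case: eqP => [<-|].
have dm' : mdeg (m - U_(k))%MM = d.
  by move: dm; rewrite {1}em mdegD mdeg1 add1n => -[].
rewrite dm em mpolyXD; apply: goodX; first by rewrite dhomogX /= dm'.
by rewrite -dm'; apply: IH.
Qed.

Lemma sub_restrictE u v p : p - restrict u v p =
  \sum_(m <- msupp p) p@_m *: ('X_[m] - restrict u v 'X_[m]).
Proof.
under eq_bigr => m _ do rewrite scalerBr.
rewrite sumrB -mpolyE; congr (_ - _).
by rewrite /restrict {1}[p]mpolyE raddf_sum; apply: eq_bigr => m _; rewrite /= linearZ.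
Qed.

Lemma restrict_sub u v p : mdvd (linear_form u) (p - restrict u v p).
Proof.
rewrite sub_restrictE.
elim/big_ind: _ => [|x y|m _]; [by exists 0; rewrite mul0r|exact: mdvd_add|].
rewrite -mul_mpolyC; apply: mdvd_mull.
by have [q e _] := restrict_mon u v m; exists q.
Qed.

(** All monomials of the support have degree [d + 1], so their separate quotients all have degree
    [d]. *)
Lemma restrict_eq0_homog u v d p : restrict u v p = 0 -> p \is d.+1.-homog ->
  exists2 q, p = q * linear_form u & q \is d.-homog.
Proof.
move=> r0 hp.
suff: exists2 q, p - restrict u v p = q * linear_form u & q \is d.-homog.
  by rewrite r0 subr0.
rewrite sub_restrictE big_seq; elim/big_ind: _ => [|x y [q -> hq] [q' -> hq']|m mp].
- by exists 0; rewrite ?mul0r ?rpred0.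
- by exists (q + q'); rewrite ?mulrDl ?rpredD.
have [q e hq] := restrict_mon u v m; exists (p@_m *: q); last first.
  by have /dhomogP/(_ _ mp)/= dm := hp; move: hq; rewrite dm => hq; apply: rpredZ.
by rewrite e scalerAl.
Qed.

Lemma mdvd_restrict u v p : \sum_k u 0 k * v 0 k = 1 ->
  mdvd (linear_form u) p <-> restrict u v p = 0.
Proof.
move=> uv; split=> [[g ->]|r0].
  rewrite /restrict rmorphM /= -!/(restrict u v _) restrict_linear_form uv.
  by rewrite mul1r subrr mulr0.
by have := restrict_sub u v p; rewrite r0 subr0.
Qed.

Lemma exists_dual u : u != 0 -> exists v : 'rV_3, \sum_k u 0 k * v 0 k = 1.
Proof.
move=> /rV0Pn [k uk]; exists (\row_j (if j == k then (u 0 k)^-1 else 0)).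
rewrite (bigD1 k) //= mxE eqxx divff // big1 ?addr0 // => i ik.
by rewrite mxE (negbTE ik) mulr0.
Qed.

Lemma linear_form_prime u p q : u != 0 ->
  mdvd (linear_form u) (p * q) -> mdvd (linear_form u) p \/ mdvd (linear_form u) q.
Proof.
move=> /exists_dual [v uv] /(mdvd_restrict _ uv).
rewrite /restrict rmorphM /= => /eqP; rewrite mulf_eq0 => /orP[] /eqP r0.
  by left; apply/(mdvd_restrict _ uv).
by right; apply/(mdvd_restrict _ uv).
Qed.

(** The restriction of [w] is the linear form of [w - (w . v) u], which vanishes only for multiples
    of [u]. *)
Lemma linear_form_ndvd u w : u != 0 -> (forall c, w != c *: u) ->
  ~ mdvd (linear_form u) (linear_form w).
Proof.
move=> u0 wu; have [v uv] := exists_dual u0.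
move=> /(mdvd_restrict _ uv); rewrite restrict_linear_form -linear_formBZ.
by move=> /linear_form_eq0/eqP; rewrite subr_eq0; apply/negP.
Qed.

(** * Derivations and tangency to the lines *)

Definition der a p : mp := dot a (fun k => mderiv k p).

Lemma derM a p q : der a (p * q) = der a p * q + p * der a q.
Proof.
rewrite /der /dot mulr_suml mulr_sumr -big_split; apply: eq_bigr => k _ /=.
by rewrite mderivM; ring.
Qed.

Lemma der_linear_form a u : der a (linear_form u) = dot a (coords u).
Proof. by apply: eq_bigr => k _; rewrite mderiv_linear_form. Qed.

Section Arrangement.
Variables (n : nat) (L : arrangement K n).
Hypothesis arrL : is_arrangement L.
Local Notation lf i := (linear_form (L i)).
Local Notation f := (defining_poly L).

Definition tangent a : Prop := forall i, mdvd (lf i) (dot a (coords (L i))).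

Lemma lf_dvd_mul_prod i (s : seq 'I_n) q : i \notin s ->
  mdvd (lf i) (q * \prod_(j <- s) lf j) -> mdvd (lf i) q.
Proof.
have [L0 Lij] := arrL; elim: s q => [|j s IH] q; first by rewrite big_nil mulr1.
rewrite inE negb_or big_cons mulrA => /andP[ij /IH{}IH] /IH /linear_form_prime.
move=> /(_ (L0 i)) [//|/linear_form_ndvd] [] //.
by move=> c; apply: Lij; rewrite eq_sym.
Qed.

Lemma prod_lf_dvd (s : seq 'I_n) q : uniq s -> (forall i, mdvd (lf i) q) ->
  mdvd (\prod_(j <- s) lf j) q.
Proof.
move=> us dq; elim: s us => [|i s IH] /=; first by exists q; rewrite big_nil mulr1.
move=> /andP[is_ /IH [g eg]].
have /(lf_dvd_mul_prod is_) [h eh] : mdvd (lf i) (g * \prod_(j <- s) lf j) by rewrite -eg.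
by exists h; rewrite big_cons eg eh mulrA.
Qed.

(** By Leibniz, line [i] divides the derivative of its own form times the product of the other
    lines; it is prime and differs from them. *)
Lemma syzygy_tangent a : der a f = 0 -> tangent a.
Proof.
move=> a0 i; move: a0.
rewrite /defining_poly (bigD1 i) //= -big_filter derM der_linear_form.
move=> /eqP; rewrite addr_eq0 => /eqP e.
apply: (@lf_dvd_mul_prod i [seq j <- index_enum 'I_n | j != i]).
  by rewrite mem_filter eqxx.
by rewrite e -mulrN mulrC; eexists.
Qed.

(** Logarithmic derivatives add over a product. *)
Lemma der_defining_poly a (g : 'I_n -> mp) :
  (forall i, dot a (coords (L i)) = g i * lf i) -> der a f = (\sum_i g i) * f.
Proof.
move=> ag; rewrite /defining_poly.
elim/big_rec2: _ => [|i h q _ IH].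
  rewrite mul0r /der /dot big1 // => k _.
  by rewrite -mpolyC1 mderivC mulr0.
by rewrite derM der_linear_form ag IH; ring.
Qed.

Lemma coordX_tangent i : dot coordX (coords (L i)) = 1 * lf i.
Proof. by rewrite linear_form_dot mul1r. Qed.

Lemma euler : der coordX f = n%:R * f.
Proof.
by rewrite (der_defining_poly coordX_tangent) sumr_const card_ord.
Qed.

(** Cramer's rule at a nonzero coefficient of line [i] shows that this line divides the determinant;
    distinct lines are coprime. *)
Lemma det_tangent_dvd a b c : tangent a -> tangent b -> tangent c ->
  mdvd f (det3 a b c).
Proof.
move=> ta tb tc; apply: (prod_lf_dvd (index_enum_uniq _)) => i.
have [L0 _] := arrL; have /rV0Pn [k Lk] := L0 i.
have [g eg] : mdvd (lf i) (coords (L i) k * det3 a b c).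
  rewrite cramer3; apply: mdvd_add; [apply: mdvd_add|];
    by rewrite mulrC; exact: mdvd_mull.
exists ((L i 0 k)^-1%:MP * g).
by rewrite -mulrA -eg /coords mulrA -mpolyCM mulVf // mpolyC1 mul1r.
Qed.

Lemma defining_poly_neq0 : f != 0.
Proof.
apply/prodf_neq0 => i _; apply: contra (arrL.1 i) => /eqP/linear_form_eq0 ->.
by [].
Qed.

Lemma defining_poly_homog : f \is n.-homog.
Proof.
suff: f \is (\sum_(i < n) 1)%N.-homog by rewrite sum1_card card_ord.
rewrite /defining_poly.
elim/big_rec2: _ => [|i d p _ hp]; first exact: dhomog1.
exact: (dhomogM (linear_form_homog _) hp).
Qed.

Lemma msize_homog d p : p != 0 -> p \is d.-homog -> msize p = d.+1.
Proof.
by move=> p0 /dhomogP/(_ _ (mlead_supp p0)) /= <-; rewrite mlead_deg.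
Qed.

Lemma det_homog a b c d e g : (forall k, a k \is d.-homog) ->
  (forall k, b k \is e.-homog) -> (forall k, c k \is g.-homog) ->
  det3 a b c \is (d + (e + g)).-homog.
Proof.
move=> ha hb hc; have hM i j : b i * c j \is (e + g).-homog by exact: dhomogM.
by rewrite /det3 rpredD ?rpredB //; apply: dhomogM => //; apply: rpredB.
Qed.

(** A tangent field multiplies [f] by the sum of its cofactors and the Euler field multiplies it by
    [n], so a multiple of the Euler field corrects the former to a syzygy. *)
Lemma tangent_syzygy d a : (0 < n)%N -> (forall k, a k \is d.+1.-homog) ->
  (forall i, exists2 g, dot a (coords (L i)) = g * lf i & g \is d.-homog) ->
  exists h : mp, let r := fun k => a k - h * coordX k in
    der r f = 0 /\ forall k, r k \is d.+1.-homog.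
Proof.
move=> n0 ha /fin_all_exists2 [g eg hg].
exists (n%:R^-1%:MP * \sum_i g i); split.
  have -> : der (fun k => a k - n%:R^-1%:MP * (\sum_i g i) * coordX k) f
      = der a f - n%:R^-1%:MP * (\sum_i g i) * der coordX f.
    by rewrite /der /dot !sum_ord3; ring.
  rewrite (der_defining_poly eg) euler -(@mpolyC_nat 3 K n).
  have cancel (x y z w : mp) : x * y = 1 -> z * w - x * z * (y * w) = 0.
    by move=> xy; have -> : z * w - x * z * (y * w) = z * w * (1 - x * y);
      [ring|rewrite xy subrr mulr0].
  by apply: cancel; rewrite -mpolyCM mulVf ?pnatr_eq0 -?lt0n // mpolyC1.
move=> k; apply: rpredB => //; rewrite -mulrA mul_mpolyC; apply: rpredZ.
have hX : coordX k \is 1.-homog by rewrite dhomogX /= mdeg1.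
have hS : \sum_i g i \is d.-homog by apply: rpred_sum.
by have := dhomogM hS hX; rewrite addn1.
Qed.

Lemma det3_sub_multiple a b c p q :
  det3 (fun k => a k - p * c k) (fun k => b k - q * c k) c = det3 a b c.
Proof. by rewrite /det3; ring. Qed.

(* Saito's criterion: [det(a, b, X)] is divisible by every line, hence by [f],
   and has degree [n], so it is a nonzero constant times [f]; Cramer's rule
   then expresses every syzygy in terms of [a], [b] and the Euler field, and
   the Euler coefficient vanishes because [X f = n f]. *)
Theorem saito_criterion d1 d2 a b : (d1 <= d2)%N -> n = (d1.+1 + d2.+2)%N ->
  (forall k, a k \is d1.+1.-homog) -> (forall k, b k \is d2.+1.-homog) ->
  (forall i, exists2 g, dot a (coords (L i)) = g * lf i & g \is d1.-homog) ->
  (forall i, exists2 g, dot b (coords (L i)) = g * lf i & g \is d2.-homog) ->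
  det3 a b coordX != 0 ->
  free_with_exponents f d1.+1 d2.+1.
Proof.
move=> d12 en ha hb ta tb D0; split=> //.
have n0 : (0 < n)%N by rewrite en.
have [h1 /= []] := tangent_syzygy n0 ha ta.
have [h2 /= []] := tangent_syzygy n0 hb tb.
move: D0; rewrite -(det3_sub_multiple a b coordX h1 h2).
set r1 := fun k => a k - _; set r2 := fun k => b k - _ => D0 s2 hr2 s1 hr1.
have tX : tangent coordX by move=> i; exists 1; exact: coordX_tangent.
have [t1 t2] := (syzygy_tangent s1, syzygy_tangent s2).
have [g eg] := det_tangent_dvd t1 t2 tX.
have f0 := defining_poly_neq0.
have [c c0 ec] : exists2 c : K, c != 0 & det3 r1 r2 coordX = c%:MP * f.
  have g0 : g != 0 by apply: contraNneq D0 => g0; rewrite eg g0 mul0r.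
  have hX k : coordX k \is 1.-homog by rewrite dhomogX /= mdeg1.
  have := msizeM g0 f0; rewrite -eg (msize_homog D0 (det_homog hr1 hr2 hX)).
  rewrite (msize_homog f0 defining_poly_homog) => e.
  (* [msize] is the degree plus one, and the determinant and [f] both have degree [n]. *)
  have /eqP/msize_poly1P [c c0 gc] : msize g = 1%N.
    by move: e; set m := mmeasure _ _ => e; have m1 : m = 1%N by lia.
  exists c => //.
  by rewrite eg gc.
have cf_inj p : p * (c%:MP * f) = 0 -> p = 0.
  move=> /eqP; rewrite mulf_eq0 mulf_eq0 mpolyC_eq0 (negbTE c0) (negbTE f0).
  by rewrite !orbF => /eqP.
have indep p q : (forall k, p * r1 k + q * r2 k = 0) -> p = 0 /\ q = 0.
  move=> e; have [] := det3_comb (k := fun=> 0) coordX e; rewrite !ec.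
  by rewrite /det3 !(mulr0, mul0r, subr0, addr0, subrr) => /cf_inj -> /cf_inj.
exists r1, r2; split=> // z; split; last first.
  move=> [p [q e]]; rewrite /jac_syzygy -/(dot z _) -/(der z f).
  have -> : der z f = p * der r1 f + q * der r2 f.
    by rewrite /der /dot !sum_ord3 !e; ring.
  by rewrite s1 s2 !mulr0 addr0.
move=> zs; have tz := syzygy_tangent zs.
have [p ep] := det_tangent_dvd tz t2 tX.
have [q eq] := det_tangent_dvd t1 tz tX.
have [h eh] := det_tangent_dvd t1 t2 tz.
have ez k : z k = c^-1%:MP * (p * r1 k + q * r2 k + h * coordX k).
  apply: (mulfI f0); apply: (mulfI (_ : c%:MP != 0)); first by rewrite mpolyC_eq0.
  have := cramer3r r1 r2 coordX z k; rewrite ec ep eq eh mulrA => ->.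
  by rewrite [f * (_ * _)]mulrCA [RHS]mulrA -mpolyCM divff // mpolyC1 mul1r; ring.
have h0 : h = 0.
  have e : der z f = c^-1%:MP * (p * der r1 f + q * der r2 f + h * der coordX f).
    by rewrite /der /dot !sum_ord3 !ez; ring.
  move: e; rewrite [der z f]zs s1 s2 !mulr0 !add0r euler => /esym/eqP.
  rewrite !mulf_eq0 mpolyC_eq0 invr_eq0 (negbTE c0) (negbTE f0) orbF /=.
  by rewrite -(@mpolyC_nat 3 K n) mpolyC_eq0 pnatr_eq0 eqn0Ngt n0 orbF => /eqP.
exists (c^-1%:MP * p), (c^-1%:MP * q) => k.
by rewrite ez h0; ring.
Qed.

End Arrangement.
End Saito.

(** * The ring Z[sqrt 2] *)

(* The pair [(a, b)] stands for [a + b sqrt 2]. *)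
Definition zsqrt2 : Type := (Z * Z)%type.
HB.instance Definition _ := GRing.Zmodule.on zsqrt2.

Section ZSqrt2.
Implicit Types x y z : zsqrt2.

Definition zmul x y : zsqrt2 := (x.1 * y.1 + (x.2 * y.2) *+ 2, x.1 * y.2 + x.2 * y.1).

Fact zmulA : associative zmul.
Proof. by move=> [a b] [c d] [e f]; rewrite /zmul /=; congr pair; ring. Qed.
Fact zmulC : commutative zmul.
Proof. by move=> [a b] [c d]; rewrite /zmul /=; congr pair; ring. Qed.
Fact zmul1 : left_id ((1, 0) : zsqrt2) zmul.
Proof. by move=> [a b]; rewrite /zmul /=; congr pair; ring. Qed.
Fact zmulDl : left_distributive zmul +%R.
Proof.
move=> [a b] [c d] [e f].
rewrite -[(a, b) + _]/((a + c, b + d) : zsqrt2) -[RHS]/((_ + _, _ + _) : zsqrt2).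
by rewrite /zmul /=; congr pair; ring.
Qed.
Fact zone_neq0 : ((1, 0) : zsqrt2) != 0.
Proof. by []. Qed.

HB.instance Definition _ :=
  GRing.Zmodule_isComNzRing.Build zsqrt2 zmulA zmulC zmul1 zmulDl zone_neq0.

End ZSqrt2.

(** For [b > 0] the 2-adic valuation is even on the left and odd on the right. *)
Lemma sqr_eq_double_sqr (a b : nat) : (a * a)%N = (2 * (b * b))%N -> b = 0%N.
Proof.
case: (posnP b) => // b0 e.
have a0 : (0 < a)%N by case: a e => //=; case: b b0.
move: e => /(congr1 (logn 2)); rewrite !lognM ?muln_gt0 ?b0 ?a0 //.
rewrite (_ : logn 2 2 = 1%N) //; move: (logn 2 a) (logn 2 b); lia.
Qed.

(** The root is a parameter, so that one construction yields the real arrangement, the complex one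
    and their conjugates. *)
Record sqrt2 (K : pzRingType) := Sqrt2 { root2 : K; root2P : root2 * root2 = 2 }.

Section Embedding.
Variables (K : numFieldType) (t : sqrt2 K).

Definition Zemb (a : Z) : K := (int_of_Z a)%:~R.

Fact Zemb_zmod : zmod_morphism Zemb.
Proof. by move=> a b; rewrite /Zemb !rmorphB. Qed.
Fact Zemb_monoid : monoid_morphism Zemb.
Proof. by split=> [|a b]; rewrite /Zemb ?rmorph1 // !rmorphM. Qed.
HB.instance Definition _ := GRing.isZmodMorphism.Build Z K Zemb Zemb_zmod.
HB.instance Definition _ := GRing.isMonoidMorphism.Build Z K Zemb Zemb_monoid.

Lemma Zemb_eq0 a : (Zemb a == 0) = (a == 0).
Proof.
rewrite /Zemb intr_eq0; apply/eqP/eqP => [|-> //].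
by rewrite -[RHS](rmorph0 int_of_Z) => /(can_inj int_of_ZK).
Qed.

Definition emb (x : zsqrt2) : K := Zemb x.1 + Zemb x.2 * root2 t.

Fact emb_zmod : zmod_morphism emb.
Proof.
move=> [a b] [c d]; rewrite -[_ - _]/((a - c, b - d) : zsqrt2) /emb /= !rmorphB.
by ring.
Qed.
Fact emb_monoid : monoid_morphism emb.
Proof.
split=> [|[a b] [c d]]; first by rewrite /emb /= rmorph1 rmorph0 mul0r addr0.
rewrite -[_ * _]/(zmul (a, b) (c, d)) /emb /zmul /= !rmorphD !rmorphM /=.
transitivity (Zemb a * Zemb c + Zemb b * Zemb d * (root2 t * root2 t)
  + (Zemb a * Zemb d + Zemb b * Zemb c) * root2 t); last by ring.
by rewrite root2P; ring.
Qed.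
HB.instance Definition _ := GRing.isZmodMorphism.Build zsqrt2 K emb emb_zmod.
HB.instance Definition _ := GRing.isMonoidMorphism.Build zsqrt2 K emb emb_monoid.

(** Irrationality of [sqrt 2]: [a = - b sqrt 2] gives [a^2 = 2 b^2]. Zero tests in the field thus
    become computations on integer pairs. *)
Lemma emb_eq0 x : (emb x == 0) = (x == 0).
Proof.
apply/idP/eqP => [|->]; last by rewrite rmorph0.
case: x => a b; rewrite /emb /= addr_eq0 => /eqP e.
have e2 : Zemb (a * a) = Zemb (2%:R * (b * b)).
  rewrite !rmorphM rmorph_nat /= e -[X in X * (_ * _)](root2P t); ring.
have b0 : b = 0.
  have : a * a = 2%:R * (b * b).
    by apply/eqP; rewrite -subr_eq0 -Zemb_eq0 rmorphB /= e2 subrr.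
  move=> /(congr1 (fun z => `|int_of_Z z|%N)); rewrite !rmorphM rmorph_nat !abszM.
  move=> /sqr_eq_double_sqr/eqP; rewrite absz_eq0 => /eqP.
  by rewrite -[RHS](rmorph0 int_of_Z) => /(can_inj int_of_ZK).
by move: e; rewrite b0 rmorph0 mul0r oppr0 => /eqP; rewrite Zemb_eq0 => /eqP ->.
Qed.

End Embedding.

(** * Reflection of homogeneous polynomials *)

(** The same tree is evaluated as a polynomial, evaluated at a point over Z[sqrt 2], and expanded
    along a line. *)
Inductive term :=
  | Var of 'I_3 | Cst of zsqrt2 | Add of term & term | Mul of term & term.

Section Term.
Implicit Type T : term.

Fixpoint eval (R : comNzRingType) (c : zsqrt2 -> R) (x : 'I_3 -> R) T : R :=
  match T with
  | Var k => x k
  | Cst a => c a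
  | Add T1 T2 => eval c x T1 + eval c x T2
  | Mul T1 T2 => eval c x T1 * eval c x T2
  end.

Lemma eval_rmorph (R S : comNzRingType) (g : {rmorphism R -> S}) c x T :
  g (eval c x T) = eval (g \o c) (g \o x) T.
Proof.
by elim: T => //= T1 e1 T2 e2; rewrite ?rmorphD ?rmorphM e1 e2.
Qed.

Lemma eval_ext (R : comNzRingType) (c d : zsqrt2 -> R) x y T :
  c =1 d -> x =1 y -> eval c x T = eval d y T.
Proof. by move=> cd xy; elim: T => //= T1 -> T2 ->. Qed.

(** [None] marks a tree that is not syntactically homogeneous. A zero constant gets degree 0
    only. *)
Fixpoint degree T : option nat :=
  match T with
  | Var _ => Some 1
  | Cst _ => Some 0
  | Add T1 T2 => if degree T1 == degree T2 then degree T1 else None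
  | Mul T1 T2 =>
      if (degree T1, degree T2) is (Some d, Some e) then Some (d + e)%N else None
  end.

Lemma eval_homog (K : numFieldType) (c : zsqrt2 -> K) T d :
  degree T = Some d -> eval (fun a => (c a)%:MP) (@coordX K) T \is d.-homog.
Proof.
elim: T d => [k|a|T1 IH1 T2 IH2|T1 IH1 T2 IH2] d /=.
- by move=> [<-]; rewrite dhomogX /= mdeg1.
- by move=> [<-]; rewrite -[_%:MP]mulr1 mul_mpolyC; apply: rpredZ; apply: dhomog1.
- by case: eqP => // e d1; rewrite rpredD ?IH1 ?IH2 // -e.
case: (degree T1) IH1 => // d1 IH1; case: (degree T2) IH2 => // d2 IH2 [<-].
by apply: dhomogM; [apply: IH1|apply: IH2].
Qed.

Fixpoint pow T n : term := if n is n'.+1 then Mul T (pow T n') else Cst 1.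

End Term.

(** * Coefficient lists, constant term first, and binary forms *)

Fixpoint ladd (p q : seq zsqrt2) : seq zsqrt2 :=
  match p, q with
  | [::], _ => q
  | _, [::] => p
  | a :: p', b :: q' => a + b :: ladd p' q'
  end.

Fixpoint lmul (p q : seq zsqrt2) : seq zsqrt2 :=
  if p is a :: p' then ladd [seq a * b | b <- q] (0 :: lmul p' q) else [::].

Fixpoint expand (x : 'I_3 -> seq zsqrt2) T : seq zsqrt2 :=
  match T with
  | Var k => x k
  | Cst a => [:: a]
  | Add T1 T2 => ladd (expand x T1) (expand x T2)
  | Mul T1 T2 => lmul (expand x T1) (expand x T2)
  end.

Lemma size_ladd p q : size (ladd p q) = maxn (size p) (size q).
Proof.
by elim: p q => [|a p IH] [|b q] //=; rewrite ?max0n ?maxn0 // IH maxnSS.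
Qed.

Lemma size_lmul p q m n : (size p <= m.+1)%N -> (size q <= n.+1)%N ->
  (size (lmul p q) <= (m + n).+1)%N.
Proof.
elim: p m => [|a p IH] m //= hp hq; rewrite size_ladd size_map /= geq_max.
apply/andP; split; first by lia.
case: m hp => [|m] hp; last by rewrite addSn ltnS IH.
by case: p hp {IH}.
Qed.

Section Form.
Variables (R : comNzRingType) (c : {rmorphism zsqrt2 -> R}) (a b : R).

(* The binary form of degree [n] in [(a, b)] with dehomogenization [p]. *)
Fixpoint form (n : nat) (p : seq zsqrt2) : R :=
  if p is u :: p' then c u * b ^+ n + a * form n.-1 p' else 0.

Lemma form_add n p q : form n (ladd p q) = form n p + form n q.
Proof.
elim: p q n => [|u p IH] [|v q] n /=; rewrite ?add0r ?addr0 //.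
by rewrite rmorphD IH; ring.
Qed.

Lemma form_scale n u p : form n [seq u * v | v <- p] = c u * form n p.
Proof.
by elim: p n => [|v p IH] n /=; rewrite ?mulr0 // rmorphM IH; ring.
Qed.

(** The size bound keeps the predecessor in [form] from truncating the exponent of [b]. *)
Lemma form_pad n m p : (size p <= n.+1)%N -> form (m + n) p = b ^+ m * form n p.
Proof.
elim: p n => [|v p IH] n /=; first by rewrite mulr0.
case: n => [|n] hp.
  by case: p hp {IH} => //= _; rewrite addn0 expr0; ring.
by rewrite addnS /= IH // !exprS exprD; ring.
Qed.

Lemma form_mul n m p q : (size p <= n.+1)%N -> (size q <= m.+1)%N ->
  form (n + m) (lmul p q) = form n p * form m q.
Proof.
move=> + hq; elim: p n => [|v p IH] n /=; first by rewrite mul0r.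
move=> hp; rewrite form_add form_scale form_pad //= rmorph0 mul0r add0r.
case: n hp => [|n] hp; last by rewrite /= IH //; ring.
by case: p hp {IH} => //= _; ring.
Qed.

Lemma form_null n p : all (eq_op^~ 0) p -> form n p = 0.
Proof.
elim: p n => //= v p IH n /andP[/eqP -> /IH ->].
by rewrite rmorph0 mul0r mulr0 addr0.
Qed.

(** On a line the coordinates are linear in two parameters, so a homogeneous term becomes a binary
    form, given by its dehomogenized coefficients. *)
Lemma form_expand x y T d : (forall k, (size (x k) <= 2)%N) ->
  (forall k, form 1 (x k) = y k) -> degree T = Some d ->
  (size (expand x T) <= d.+1)%N /\ form d (expand x T) = eval c y T.
Proof.
move=> hx xy; elim: T d => [k|u|T1 IH1 T2 IH2|T1 IH1 T2 IH2] d /=.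
- by move=> [<-].
- by move=> [<-] /=; rewrite mulr0 addr0 mulr1.
- case: eqP => // e d1; have [s1 <-] := IH1 _ d1.
  have [s2 <-] := IH2 _ (etrans (esym e) d1).
  by rewrite form_add size_ladd geq_max s1 s2.
case: (degree T1) IH1 => // d1 /(_ _ erefl) [s1 <-].
case: (degree T2) IH2 => // d2 /(_ _ erefl) [s2 <-] [<-].
by rewrite form_mul // size_lmul.
Qed.

End Form.

(** * The arrangement and its tangent fields *)

(* The product of the lines parallel to [x = 0] other than the line at infinity,
   [x (2 x^2 - z^2) (2 x^2 - s^2 z^2) (2 x^2 - s^-2 z^2)] with [s = 1 + sqrt 2]. *)
Definition axis_factor (x z : term) : term :=
  let x2 := Mul x x in let z2 := Mul z z in
  let m a := Cst (a, 0) in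
  Mul x (Mul (Add (Mul (m 2) x2) (Mul (m (-1)) z2))
    (Add (Add (Mul (m 4) (Mul x2 x2)) (Mul (m (-12)) (Mul x2 z2))) (Mul z2 z2))).

(** Exponents count squares: apart from [axis_factor], a component is even in each variable,
    matching the symmetry in the axes. *)
Definition monomial (x y z : term) (m : Z * (nat * nat * nat)) : term :=
  let: (a, (i, j, k)) := m in
  Mul (Cst (a, 0)) (Mul (pow (Mul x x) i) (Mul (pow (Mul y y) j) (pow (Mul z z) k))).

(** The fold starts from a monomial because a zero constant would have syntactic degree 0. *)
Definition component m0 (s : seq (Z * (nat * nat * nat))) (x y z : term) : term :=
  Mul (axis_factor x z)
    (foldr (fun m => Add (monomial x y z m)) (monomial x y z m0) s).

(** The zero third component makes the field tangent to the line at infinity [z = 0]. *)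
Definition field m0 s (k : 'I_3) : term :=
  match val k with
  | 0 => component m0 s (Var o0) (Var o1) (Var o2)
  | 1 => component m0 s (Var o1) (Var o0) (Var o2)
  | _ => Cst 0
  end.

(* The coefficients below solve the linear system expressing tangency to the
   lines not parallel to the axes. *)
Definition theta1 := field (6, (0, 0, 4)%N) [::
    (-127, (0, 1, 3)%N); (819, (0, 2, 2)%N); (-517, (0, 3, 1)%N); (99, (0, 4, 0)%N);
    (-43, (1, 0, 3)%N); (-140, (1, 1, 2)%N); (-123, (1, 2, 1)%N); (22, (1, 3, 0)%N);
    (49, (2, 0, 2)%N); (45, (2, 1, 1)%N); (12, (2, 2, 0)%N); (-13, (3, 0, 1)%N);
    (-6, (3, 1, 0)%N); (1, (4, 0, 0)%N)].

Definition theta2 := field (1, (0, 0, 5)%N) [::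
    (-21, (0, 1, 4)%N); (133, (0, 2, 3)%N); (-57, (0, 3, 2)%N); (-42, (0, 4, 1)%N);
    (42, (0, 5, 0)%N); (-7, (1, 0, 4)%N); (-28, (1, 1, 3)%N); (-31, (1, 2, 2)%N);
    (70, (1, 3, 1)%N); (-96, (1, 4, 0)%N); (7, (2, 0, 3)%N); (25, (2, 1, 2)%N);
    (-14, (2, 2, 1)%N); (68, (2, 3, 0)%N); (-1, (3, 0, 2)%N); (-14, (3, 1, 1)%N);
    (-16, (3, 2, 0)%N); (2, (4, 1, 0)%N)].

(** * The lines and the tangency test *)

Definition r2 : zsqrt2 := (0, 1).
Definition vec3 (T : Type) (a b c : T) (k : 'I_3) : T :=
  match val k with 0 => a | 1 => b | _ => c end.

(** The line at infinity, the eight mirrors, then four directions for each of six offsets. The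
    factor [r2] gives these four normals the same length. *)
Definition lines : seq ('I_3 -> zsqrt2) :=
  [:: vec3 0 0 1; vec3 1 0 0; vec3 0 1 0; vec3 1 1 0; vec3 1 (-1) 0;
      vec3 (r2 - 1) 1 0; vec3 (r2 - 1) (-1) 0; vec3 (r2 + 1) 1 0; vec3 (r2 + 1) (-1) 0]
  ++ flatten [seq [:: vec3 r2 0 o; vec3 0 r2 o; vec3 1 1 o; vec3 1 (-1) o]
             | o <- [:: 1; -1; r2 - 1; 1 - r2; r2 + 1; - r2 - 1]].

Definition line (i : nat) : 'I_3 -> zsqrt2 := nth (fun=> 0) lines i.

(** If the norm [n] is 1 or -1, the inverse is [n] times the conjugate; for any other norm [is_unit]
    fails. *)
Definition unit_inv (x : zsqrt2) : zsqrt2 :=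
  let n := x.1 * x.1 - 2 * x.2 * x.2 in (n * x.1, - (n * x.2)).

Definition is_unit (x : zsqrt2) : bool := x * unit_inv x == 1.

(* A parametrization of the line [u], which has a coefficient that is a unit
   of Z[sqrt 2], by the coordinates other than the one eliminated. *)
Definition pivot (u : 'I_3 -> zsqrt2) : 'I_3 :=
  if is_unit (u o0) then o0 else if is_unit (u o1) then o1 else o2.

(** The direction of projection onto the line: it pairs to 1 with [u] when the pivot coefficient is
    a unit. *)
Definition dual (u : 'I_3 -> zsqrt2) (k : 'I_3) : zsqrt2 :=
  if k == pivot u then unit_inv (u k) else 0.

Definition free1 (u : 'I_3 -> zsqrt2) : 'I_3 := if pivot u == o0 then o1 else o0.
Definition free2 (u : 'I_3 -> zsqrt2) : 'I_3 := if pivot u == o2 then o1 else o2.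

(** The coefficient of [free2], the homogenizing coordinate, comes first. *)
Definition param (u : 'I_3 -> zsqrt2) (k : 'I_3) : seq zsqrt2 :=
  if k == pivot u then
    [:: - (dual u k * u (free2 u)); - (dual u k * u (free1 u))]
  else if k == free1 u then [:: 0; 1] else [:: 1; 0].

(* The third component is left out because it vanishes for [field]. *)
Definition dot_term (u : 'I_3 -> zsqrt2) (T : 'I_3 -> term) : term :=
  Add (Mul (T o0) (Cst (u o0))) (Mul (T o1) (Cst (u o1))).

Definition tangent_check (d : nat) (T : 'I_3 -> term) : bool :=
  all (fun u => (degree (dot_term u T) == Some d) && is_unit (u (pivot u)) &&
                all (eq_op^~ 0) (expand (param u) (dot_term u T))) lines.

Lemma theta1_tangent : tangent_check 15 theta1.
Proof. by vm_compute. Qed.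
Lemma theta2_tangent : tangent_check 17 theta2.
Proof. by vm_compute. Qed.

Lemma theta1_degree : degree (theta1 o0) = Some 15%N /\ degree (theta1 o1) = Some 15%N.
Proof. by split; vm_compute. Qed.

Lemma theta2_degree : degree (theta2 o0) = Some 17%N /\ degree (theta2 o1) = Some 17%N.
Proof. by split; vm_compute. Qed.

(** One nonzero value shows that the determinant is a nonzero polynomial. As a multiple of [f] it
    vanishes on the lines, so the point must avoid them. *)
Definition test_point : 'I_3 -> zsqrt2 := vec3 1 3 1.

Lemma det_test_point : det3 (fun k => eval id test_point (theta1 k))
  (fun k => eval id test_point (theta2 k)) test_point != 0.
Proof. by vm_compute. Qed.

Lemma det3_rmorph (R S : comNzRingType) (g : {rmorphism R -> S}) a b c :
  g (det3 a b c) = det3 (g \o a) (g \o b) (g \o c).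
Proof. by rewrite /det3 /= !(rmorphB, rmorphD, rmorphM). Qed.

Lemma cross_rmorph (R S : comNzRingType) (g : {rmorphism R -> S}) a b :
  g \o cross a b =1 cross (g \o a) (g \o b).
Proof. by apply: forall_ord3; rewrite /cross /= rmorphB !rmorphM. Qed.

Definition octagonal (K : numFieldType) (t : sqrt2 K) : arrangement K 33 :=
  [ffun i => \row_k emb t (line (val i) k)].

(** * Freeness of the octagonal arrangement *)

Section Freeness.
Variables (K : numFieldType) (t : sqrt2 K).
Local Notation mp := {mpoly K[3]}.
Local Notation cst := ((mpolyC 3 (R := K)) \o emb t).
Local Notation L := (octagonal t).

Definition derivation (T : 'I_3 -> term) (k : 'I_3) : mp := eval cst (@coordX K) (T k).

Lemma octagonalE i k : L i 0 k = emb t (line (val i) k).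
Proof. by rewrite ffunE mxE. Qed.

Lemma linear_form3 (u : 'rV[K]_3) : linear_form u =
  (u 0 o0)%:MP * 'X_o0 + (u 0 o1)%:MP * 'X_o1 + (u 0 o2)%:MP * 'X_o2.
Proof. exact: sum_ord3. Qed.

(** Projecting along [dual u] fixes the free coordinates and replaces the pivot coordinate by its
    value on the line. *)
Lemma restrict_param (u : 'I_3 -> zsqrt2) (U V : 'rV[K]_3) :
  (forall k, U 0 k = emb t (u k)) -> (forall k, V 0 k = emb t (dual u k)) ->
  is_unit (u (pivot u)) ->
  forall k, form cst 'X_(free1 u) 'X_(free2 u) 1 (param u k) = restrict U V 'X_k.
Proof.
move=> eU eV /eqP unit_u k; rewrite restrictX linear_form3 !eU eV.
have pu : cst (u (pivot u)) * cst (dual u (pivot u)) = 1.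
  by rewrite -rmorphM /dual eqxx unit_u rmorph1.
have d0 j : j != pivot u -> dual u j = 0 by rewrite /dual => /negbTE ->.
have cstE z : (emb t z)%:MP = cst z by [].
move: pu d0; rewrite /param /free1 /free2 !cstE.
move: (dual u) => d.
have : [\/ pivot u = o0, pivot u = o1 | pivot u = o2].
  by rewrite /pivot; do 2?[case: ifP => _]; constructor.
case=> -> /= pu d0; [have d1 := d0 o1 isT; have d2 := d0 o2 isT
  |have d1 := d0 o0 isT; have d2 := d0 o2 isT|have d1 := d0 o0 isT; have d2 := d0 o1 isT];
  move: k; apply: forall_ord3 => /=;
  rewrite ?d1 ?d2 ?(rmorph0, rmorph1, rmorphN, rmorphM) /=;
  (try by ring); by rewrite -['X_ _ in X in _ = X - _]mul1r -pu; ring.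
Qed.

Lemma derivation_tangent d T : tangent_check d.+1 T ->
  eval cst (@coordX K) (T o2) = 0 ->
  forall i, exists2 g : mp, dot (derivation T) (coords (L i)) = g * linear_form (L i)
    & g \is d.-homog.
Proof.
move=> chk T2 i; have /andP[/andP[/eqP dT uu] nT] :=
  all_nthP (fun=> 0) chk (val i) (ltn_ord i).
set u := nth _ _ _ in dT uu nT.
have eU k : L i 0 k = emb t (u k) by exact: octagonalE.
pose V := \row_k emb t (dual u k).
have eV k : V 0 k = emb t (dual u k) by rewrite mxE.
have -> : dot (derivation T) (coords (L i)) = eval cst (@coordX K) (dot_term u T).
  by rewrite /dot sum_ord3 /derivation T2 mul0r addr0 /coords !eU.
apply: (restrict_eq0_homog (u := L i) (v := V)); last exact: eval_homog.
rewrite /restrict eval_rmorph.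
rewrite (@eval_ext _ _ cst _ (fun k => restrict (L i) V 'X_k)) //; last first.
  by move=> a /=; rewrite comp_mpolyC.
have sz k : (size (param u k) <= 2)%N by rewrite /param; do 2?[case: ifP => _].
have [_ <-] := form_expand sz (restrict_param eU eV uu) dT.
exact: form_null.
Qed.

Lemma octagonal_free : is_arrangement L -> free_with_exponents (defining_poly L) 15 17.
Proof.
move=> arrL.
have hom d T : degree (T o0) = Some d -> degree (T o1) = Some d ->
    eval cst (@coordX K) (T o2) = 0 -> forall k, derivation T k \is d.-homog.
  move=> h0 h1 h2; apply: forall_ord3; [exact: eval_homog|exact: eval_homog|].
  by rewrite /derivation h2 rpred0.
have [d10 d11] := theta1_degree; have [d20 d21] := theta2_degree.
have z1 : eval cst (@coordX K) (theta1 o2) = 0 by exact: rmorph0.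
have z2 : eval cst (@coordX K) (theta2 o2) = 0 by exact: rmorph0.
(* The cofactors have degrees 14 and 16, one below the fields, and [15 + 17 + 1 = 33]. *)
apply: (@saito_criterion _ _ _ arrL 14 16 (derivation theta1) (derivation theta2)) => //.
- exact: hom.
- exact: hom.
- exact: derivation_tangent theta1_tangent z1.
- exact: derivation_tangent theta2_tangent z2.
apply: contra_neq det_test_point => D0; apply/eqP; rewrite -(emb_eq0 t).
rewrite det3_rmorph.
have ev T k : (emb t \o (fun k => eval id test_point (T k))) k
    = (meval (emb t \o test_point) \o derivation T) k.
  rewrite /= /derivation !eval_rmorph; apply: eval_ext => [a|j] /=.
    by rewrite mevalC.
  by rewrite /coordX mevalXU.
have ext (a b c a' b' c' : 'I_3 -> K) : a =1 a' -> b =1 b' -> c =1 c' ->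
    det3 a b c = det3 a' b' c'.
  by move=> ea eb ec; rewrite /det3 !ea !eb !ec.
have := congr1 (meval (emb t \o test_point)) D0; rewrite det3_rmorph rmorph0 => <-.
apply/eqP; apply: ext => [k|k|k]; [exact: ev|exact: ev|].
by rewrite /= /coordX mevalXU.
Qed.

End Freeness.

(** * Incidences *)

Section Plane.
Variable K : fieldType.
Implicit Types a b u v p : 'I_3 -> K.

Definition nonzero a : Prop := exists k, a k != 0.

Definition proportional a b : Prop := exists2 c, c != 0 & forall k, b k = c * a k.

Lemma proportional_sym a b : proportional a b -> proportional b a.
Proof.
move=> [c c0 e]; exists c^-1; first by rewrite invr_eq0.
by move=> k; rewrite e mulrA mulVf // mul1r.
Qed.

Lemma proportional_trans b a d :
  proportional a b -> proportional b d -> proportional a d.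
Proof.
move=> [c c0 e] [c' c0' e']; exists (c' * c); first by rewrite mulf_neq0.
by move=> k; rewrite e' e mulrA.
Qed.

Lemma cross_eq0_comm a b : (forall k, cross a b k = 0) ->
  forall j k, a j * b k = a k * b j.
Proof.
move=> e; have := (e o0, e o1, e o2); rewrite /cross /=.
move=> [[/eqP + /eqP +] /eqP]; rewrite !subr_eq0 => /eqP e0 /eqP e1 /eqP e2.
by do 2![apply: forall_ord3].
Qed.

Lemma cross_eq0_proportional a b : nonzero a -> nonzero b ->
  (forall k, cross a b k = 0) -> proportional a b.
Proof.
move=> [k ak] [j bj] /cross_eq0_comm e.
have eb i : b i = b k / a k * a i by rewrite mulrAC [b k * _]mulrC -e mulrAC divff ?mul1r.
exists (b k / a k) => //; apply: contraNneq bj => c0.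
by rewrite eb c0 mul0r.
Qed.

Lemma cross_cross p a b k : cross p (cross a b) k = a k * dot b p - b k * dot a p.
Proof.
by move: k; apply: forall_ord3; rewrite /dot !sum_ord3 /cross /=; ring.
Qed.

Lemma dot_crossl a b : dot a (cross a b) = 0.
Proof. by rewrite /dot sum_ord3 /cross /=; ring. Qed.

Lemma dot_crossr a b : dot b (cross a b) = 0.
Proof. by rewrite /dot sum_ord3 /cross /=; ring. Qed.

(** The triple product [p x (a x b) = a (b . p) - b (a . p)] vanishes. *)
Lemma orthogonal_cross p a b : nonzero (cross a b) -> nonzero p ->
  dot a p = 0 -> dot b p = 0 -> proportional p (cross a b).
Proof.
move=> nc np ea eb; apply: cross_eq0_proportional => // k.
by rewrite cross_cross ea eb !mulr0 subr0.
Qed.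

Lemma dotC a b : dot a b = dot b a.
Proof. by rewrite /dot !sum_ord3; ring. Qed.

Lemma dot_proportional a p u : proportional p u -> (dot a p == 0) = (dot a u == 0).
Proof.
move=> [c c0 e]; have -> : dot a u = c * dot a p by rewrite /dot !sum_ord3 !e; ring.
by rewrite mulf_eq0 (negbTE c0).
Qed.

Lemma row_nonzero (p : 'rV[K]_3) : p != 0 -> nonzero (p 0).
Proof. by move=> /rV0Pn. Qed.

Lemma cross_nonzero_row (u v : 'rV[K]_3) : u != 0 -> v != 0 ->
  (forall c, v != c *: u) -> nonzero (cross (u 0) (v 0)).
Proof.
move=> u0 v0 uv.
case: (boolP [forall k, cross (u 0) (v 0) k == 0]) => [/forallP c0|]; last first.
  by rewrite negb_forall => /existsP [k ck]; exists k.
have [k|c _ e] := cross_eq0_proportional (row_nonzero u0) (row_nonzero v0).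
  exact/eqP.
by have /eqP [] := uv c; apply/rowP => k; rewrite mxE e.
Qed.

Section Arrangement.
Variables (n : nat) (L : arrangement K n).

Lemma on_lineE i (p : 'rV[K]_3) : on_line L i p = (dot (L i 0) (p 0) == 0).
Proof. by []. Qed.

Hypothesis arrL : is_arrangement L.

Lemma lines_cross i j : i != j -> nonzero (cross (L i 0) (L j 0)).
Proof.
by move=> ij; apply: cross_nonzero_row; rewrite ?arrL.1 // => c; rewrite arrL.2 // eq_sym.
Qed.

(** The point is the cross product of two of its lines, so incidence with a third is a determinant
    free of the point. *)
Lemma on_line_det3 i j (p : 'rV[K]_3) k : i != j -> p != 0 ->
  on_line L i p -> on_line L j p ->
  on_line L k p = (det3 (L i 0) (L j 0) (L k 0) == 0).
Proof.
move=> ij p0 /eqP pi /eqP pj; rewrite on_lineE det3_dot; apply: dot_proportional.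
by apply: orthogonal_cross => //; [exact: lines_cross|exact: row_nonzero].
Qed.

Definition meet i j : 'rV[K]_3 := \row_k cross (L i 0) (L j 0) k.

Lemma meetE i j : meet i j 0 =1 cross (L i 0) (L j 0).
Proof. by move=> k; rewrite mxE. Qed.

Lemma dot_meet a i j : dot a (meet i j 0) = dot a (cross (L i 0) (L j 0)).
Proof. by apply: eq_bigr => k _; rewrite meetE. Qed.

Lemma on_line_meet i j k :
  on_line L k (meet i j) = (det3 (L i 0) (L j 0) (L k 0) == 0).
Proof. by rewrite on_lineE det3_dot dot_meet. Qed.

Lemma meet_neq0 i j : i != j -> meet i j != 0.
Proof.
by move=> /lines_cross [k ck]; apply/rV0Pn; exists k; rewrite meetE.
Qed.

Lemma on_line_meetl i j : on_line L i (meet i j).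
Proof. by rewrite on_lineE dot_meet dot_crossl. Qed.

Lemma on_line_meetr i j : on_line L j (meet i j).
Proof. by rewrite on_lineE dot_meet dot_crossr. Qed.

(** Rigidity reads the intersection lattice through such triples. *)
Lemma concurrent3 i j k : i != j ->
  concurrent L [set i; j; k] <-> det3 (L i 0) (L j 0) (L k 0) = 0.
Proof.
move=> ij; split=> [[p [p0 Hp]]|d0].
  by apply/eqP; rewrite -(on_line_det3 _ ij p0) Hp // !inE eqxx ?orbT.
exists (meet i j); split; first exact: meet_neq0.
move=> l; rewrite !inE -orbA => /or3P[] /eqP ->.
- exact: on_line_meetl.
- exact: on_line_meetr.
by rewrite on_line_meet d0.
Qed.

End Arrangement.
End Plane.

(** Concurrent lines are collinear points of the dual plane. *)
Definition collinear (i j k : nat) : bool := det3 (line i) (line j) (line k) == 0.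

Definition pairs (n : nat) : seq (nat * nat) :=
  [seq (i, j) | j <- iota 0 n, i <- iota 0 j].

Definition point_class (ij : nat * nat) : seq nat :=
  [seq k <- iota 0 33 | collinear ij.1 ij.2 k].

Definition point_classes : seq (seq nat) := undup (map point_class (pairs 33)).

(** The counts account for every pair of lines: [108 + 3 * 40 + 10 * 16 + 28 * 5 = 33 * 32 / 2]. *)
Lemma point_classes_sizes : let n k := count (fun c => size c == k) point_classes in
  [&& n 2 == 108, n 3 == 40, n 5 == 16, n 8 == 5 &
      all (fun c => size c \in [:: 2; 3; 5; 8]) point_classes]%N.
Proof. by vm_compute. Qed.

Lemma lines_independent :
  all (fun ij => [|| cross (line ij.1) (line ij.2) o0 != 0,
     cross (line ij.1) (line ij.2) o1 != 0 | cross (line ij.1) (line ij.2) o2 != 0])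
    (pairs 33).
Proof. by vm_compute. Qed.

(** * Transfer of the computed incidences to the plane *)

Section Incidences.
Variables (K : numFieldType) (t : sqrt2 K).
Local Notation L := (octagonal t).
Implicit Types i j k : 'I_33.

Lemma octagonal_det3 i j k :
  (det3 (L i 0) (L j 0) (L k 0) == 0) = collinear i j k.
Proof.
rewrite /collinear -(emb_eq0 t) det3_rmorph.
by congr (_ == 0); rewrite /det3 !octagonalE.
Qed.

Local Opaque collinear.

Lemma mem_pairs n (i j : nat) : (i, j) \in pairs n = (i < j < n)%N.
Proof.
apply/allpairsPdep/idP => [[j' [i' [jn ij [-> ->]]]]|/andP[ij jn]].
  by move: jn ij; rewrite !mem_iota !add0n /= => -> ->.
by exists j, i; rewrite !mem_iota !add0n ij jn.
Qed.

Lemma emb_lines_cross i j : (i < j)%N ->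
  nonzero (cross (emb t \o line i) (emb t \o line j)).
Proof.
move=> ij; have /allP/(_ (val i, val j)) := lines_independent.
rewrite mem_pairs ij ltn_ord => /(_ isT) /or3P[] c0;
  by eexists; rewrite -cross_rmorph /= emb_eq0; exact: c0.
Qed.

Lemma octagonal_is_arrangement : is_arrangement L.
Proof.
have nprop i j c : (i < j)%N -> L i = c *: L j -> False.
  move=> ij e; have [k] := emb_lines_cross ij.
  have -> : cross (emb t \o line i) (emb t \o line j) k = cross (L i 0) (L j 0) k.
    by rewrite /cross /= -!octagonalE.
  rewrite e /cross !mxE; case: (val k) => [|[|_]]; rewrite (_ : _ - _ = 0) ?eqxx //; ring.
have nz i : L i != 0.
  apply/eqP => e; have [i0|i0] := leqP i 0%N.
    by apply: (@nprop i ord_max 0); [rewrite (leq_ltn_trans i0)|rewrite e scale0r].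
  have [k] := emb_lines_cross (i0 : (ord0 < i)%N).
  rewrite /cross /= -!octagonalE e !mxE; case: (val k) => [|[|_]];
    by rewrite !(mulr0, subr0) ?eqxx.
split=> // i j c ij; apply/eqP => e.
case: (ltngtP i j) => [lt|lt|/val_inj eij]; last by rewrite eij eqxx in ij.
  exact: nprop lt e.
have c0 : c != 0 by apply: contraNneq (nz i) => c0; rewrite e c0 scale0r.
by apply: (nprop _ _ c^-1 lt); rewrite e scalerA mulVf // scale1r.
Qed.

Definition set_of_class (c : seq nat) : {set 'I_33} := [set i | val i \in c].

Lemma point_classesP c : c \in point_classes ->
  exists i j, (i < j)%N /\ c = point_class (val i, val j).
Proof.
rewrite mem_undup => /mapP[[i j] + ->]; rewrite mem_pairs => /andP[ij jn].
by exists (Ordinal (ltn_trans ij jn)), (Ordinal jn).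
Qed.

Lemma set_of_point_class i j :
  set_of_class (point_class (val i, val j)) = [set k : 'I_33 | collinear i j k].
Proof.
by apply/setP => k; rewrite !inE mem_filter mem_iota /= add0n ltn_ord andbT.
Qed.

Lemma mem_point_classes i j : (i < j)%N ->
  point_class (val i, val j) \in point_classes.
Proof. by move=> ij; rewrite mem_undup map_f // mem_pairs ij ltn_ord. Qed.

Lemma uniq_point_classes : uniq point_classes.
Proof. exact: undup_uniq. Qed.

Lemma card_set_of_class c : c \in point_classes -> #|set_of_class c| = size c.
Proof.
move=> /point_classesP [i [j [_ ->]]]; rewrite set_of_point_class cardsE cardE.
rewrite /point_class /enum_mem !size_filter -val_enum_ord count_map enumT.
by apply: eq_count.
Qed.

Lemma set_of_class_inj : {in point_classes &, injective set_of_class}.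
Proof.
move=> _ _ /point_classesP [i [j [_ ->]]] /point_classesP [i' [j' [_ ->]]].
rewrite (set_of_point_class i j) (set_of_point_class i' j') => /setP e.
apply: eq_in_filter => k; rewrite mem_iota add0n => /= kn.
by have := e (Ordinal kn); rewrite !inE.
Qed.

Lemma lines_through_class i j p : (i < j)%N -> p != 0 ->
  i \in lines_through L p -> j \in lines_through L p ->
  lines_through L p = set_of_class (point_class (val i, val j)).
Proof.
rewrite !inE => ij p0 pi pj; rewrite set_of_point_class; apply/setP => k; rewrite !inE.
rewrite (on_line_det3 octagonal_is_arrangement _ _ p0 pi pj) ?octagonal_det3 //.
by rewrite -val_eqE ltn_eqF.
Qed.

(** Two lines through a point determine the others, so points of multiplicity [k >= 2] correspond to
    classes of size [k]. *)
Lemma octagonal_nk (k : nat) : (2 <= k)%N ->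
  nk_eq L k (count (fun c => size c == k) point_classes).
Proof.
(* Generalizing over [point_classes] prevents unification from evaluating it. *)
move: point_classesP mem_point_classes uniq_point_classes.
move: card_set_of_class set_of_class_inj.
move: point_classes => cs card_cs inj_cs csP mem_cs uniq_cs k2.
exists [seq set_of_class c | c <- cs & size c == k]; split.
- rewrite map_inj_in_uniq; first exact: filter_uniq.
  move=> c d; rewrite !mem_filter => /andP[_ cP] /andP[_ dP].
  exact: inj_cs.
- by rewrite size_map size_filter.
move=> S; split=> [/mapP[c]|[Sk [p [p0 eS]]]].
  rewrite mem_filter => /andP[/eqP sk cP] ->; rewrite card_cs //.
  split=> //; have [i [j [ij ->]]] := csP _ cP.
  have nij : i != j by rewrite -val_eqE ltn_eqF.
  have m0 := meet_neq0 octagonal_is_arrangement nij.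
  exists (meet L i j); split=> //; apply: lines_through_class => //; rewrite inE.
    exact: on_line_meetl.
  exact: on_line_meetr.
have /card_gt1P [i [j [iS jS ij]]] : (1 < #|S|)%N by rewrite Sk.
wlog lt : i j iS jS ij / (i < j)%N.
  move=> W; case: (ltngtP i j) => [lt|lt|/val_inj e]; first exact: (W i j).
    by apply: (W j i) => //; rewrite eq_sym.
  by rewrite e eqxx in ij.
rewrite -eS in iS jS *; rewrite -Sk -eS (lines_through_class lt p0 iS jS).
have cP := mem_cs _ _ lt.
by rewrite map_f // mem_filter card_cs // eqxx.
Qed.

Lemma octagonal_incidences :
  nk_eq L 2 108 /\ nk_eq L 3 40 /\ nk_eq L 5 16 /\ nk_eq L 8 5 /\
  (forall k : nat, (2 <= k)%N -> k <> 2%N -> k <> 3%N -> k <> 5%N -> k <> 8%N ->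
     nk_eq L k 0).
Proof.
move: point_classes_sizes octagonal_nk; move: point_classes => cs.
move=> /= /and5P[/eqP c2 /eqP c3 /eqP c5 /eqP c8 /allP sz] nk_cs.
split; first by have := nk_cs 2%N isT; rewrite c2.
split; first by have := nk_cs 3%N isT; rewrite c3.
split; first by have := nk_cs 5%N isT; rewrite c5.
split; first by have := nk_cs 8%N isT; rewrite c8.
move=> k k2 n2 n3 n5 n8.
have := nk_cs k k2; rewrite (_ : count _ cs = 0%N) //.
apply/eqP; rewrite -leqn0 leqNgt -has_count; apply/hasPn => c /sz.
by rewrite !inE => /or4P[] /eqP ->; apply/eqP => /esym.
Qed.

End Incidences.

(** * Rigidity *)

Definition step : Type := ((nat * nat) * (nat * nat) * nat)%type.

Definition nonzero_bool (u : 'I_3 -> zsqrt2) : bool :=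
  [|| u o0 != 0, u o1 != 0 | u o2 != 0].

(* Line [m] is the join of the points where lines [i], [j] and lines [k], [l] meet. *)
Definition step_ok (known : seq nat) (s : step) : bool :=
  let: ((i, j), (k, l), m) := s in
  [&& all (mem known) [:: i; j; k; l], all (ltn^~ 33) [:: i; j; k; l; m],
      i != j, k != l, collinear i j m, collinear k l m, nonzero_bool (line m) &
      nonzero_bool (cross (cross (line i) (line j)) (cross (line k) (line l)))].

Fixpoint plan_ok (known : seq nat) (p : seq step) : bool :=
  if p is s :: p' then step_ok known s && plan_ok (s.2 :: known) p' else true.

(** Lines fixed by the square alone: the line at infinity through the meets of opposite sides, the
    axes through opposite vertices, and a parallel to a side through the centre. *)
Definition rational_plan : seq step :=
  [:: ((11, 15), (12, 16), 0); ((11, 16), (12, 15), 1);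
      ((11, 12), (15, 16), 2); ((0, 12), (1, 2), 4)]%N.

Definition full_plan : seq step :=
  [:: ((11, 15), (12, 16), 0); ((11, 16), (12, 15), 1); ((11, 12), (15, 16), 2);
      ((11, 15), (13, 16), 23); ((12, 16), (13, 15), 24); ((11, 15), (12, 13), 31);
      ((11, 13), (12, 16), 32); ((0, 11), (1, 2), 3); ((0, 12), (1, 2), 4);
      ((1, 2), (13, 16), 5); ((1, 2), (13, 15), 6); ((1, 2), (11, 13), 7);
      ((1, 2), (11, 24), 8); ((0, 2), (11, 24), 10); ((0, 2), (12, 23), 14);
      ((0, 1), (11, 24), 17); ((0, 2), (13, 16), 18); ((0, 11), (1, 24), 19);
      ((0, 12), (1, 23), 20); ((0, 2), (13, 15), 22); ((0, 2), (11, 13), 26);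
      ((0, 11), (1, 32), 27); ((0, 12), (1, 31), 28); ((0, 1), (15, 32), 29);
      ((0, 2), (12, 13), 30); ((0, 1), (3, 14), 9); ((0, 1), (3, 18), 21);
      ((0, 1), (3, 30), 25)]%N.

(** The sides [x + y = -1], [x - y = -1], [x + y = 1] and [x - y = 1] of the square. *)
Definition frame : seq nat := [:: 11; 12; 15; 16]%N.

Lemma rational_plan_ok : plan_ok frame rational_plan.
Proof. by vm_compute. Qed.

Lemma full_plan_ok : plan_ok (13%N :: frame) full_plan.
Proof. by vm_compute. Qed.

Lemma full_plan_complete :
  all (mem ((13%N :: frame) ++ [seq s.2 | s <- full_plan])) (iota 0 33).
Proof. by vm_compute. Qed.

Section Join.
Variable K : fieldType.
Implicit Types a b c d u w : 'I_3 -> K.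

Lemma det3_proportional a a' b b' u u' : proportional a a' -> proportional b b' ->
  proportional u u' -> (det3 a' b' u' == 0) = (det3 a b u == 0).
Proof.
move=> [x x0 ea] [y y0 eb] [z z0 eu].
have -> : det3 a' b' u' = x * y * z * det3 a b u by rewrite /det3 !ea !eb !eu; ring.
by rewrite !mulf_eq0 (negbTE x0) (negbTE y0) (negbTE z0).
Qed.

Lemma proportional_refl a : proportional a a.
Proof. by exists 1; rewrite ?oner_eq0 // => k; rewrite mul1r. Qed.

Lemma join_unique a b c d u w :
  det3 a b u = 0 -> det3 c d u = 0 -> det3 a b w = 0 -> det3 c d w = 0 ->
  nonzero (cross (cross a b) (cross c d)) -> nonzero u -> nonzero w ->
  proportional u w.
Proof.
rewrite !det3_dot => au cu aw cw nc nu nw.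
apply: (proportional_trans (b := cross (cross a b) (cross c d))).
  by apply: orthogonal_cross => //; rewrite dotC.
by apply: proportional_sym; apply: orthogonal_cross => //; rewrite dotC.
Qed.

End Join.

(** * Reconstruction of a realization from its frame *)

Section Realization.
Variables (K : numFieldType) (N : nat -> 'I_3 -> K).
Hypothesis N_nonzero : forall i, (i < 33)%N -> nonzero (N i).
Hypothesis N_det3 : forall i j k, (i < 33)%N -> (j < 33)%N -> (k < 33)%N -> i != j ->
  (det3 (N i) (N j) (N k) == 0) = collinear i j k.

(** The representatives are arbitrary vectors, which allows coordinates with an unknown
    parameter. *)
Lemma join_step i j k l m (vi vj vk vl vm : 'I_3 -> K) :
  all (ltn^~ 33) [:: i; j; k; l; m] -> i != j -> k != l ->
  collinear i j m -> collinear k l m ->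
  proportional vi (N i) -> proportional vj (N j) ->
  proportional vk (N k) -> proportional vl (N l) ->
  nonzero vm -> det3 vi vj vm = 0 -> det3 vk vl vm = 0 ->
  nonzero (cross (cross vi vj) (cross vk vl)) -> proportional vm (N m).
Proof.
move=> /and5P[hi hj hk hl /andP[hm _]] ij kl cij ckl pi pj pk pl nm dij dkl nc.
apply: (join_unique (a := vi) (b := vj) (c := vk) (d := vl)) => //; last exact: N_nonzero.
  by apply/eqP; rewrite -(det3_proportional pi pj (proportional_refl _)) N_det3.
by apply/eqP; rewrite -(det3_proportional pk pl (proportional_refl _)) N_det3.
Qed.

Section Plan.
Variable t : sqrt2 K.
Local Notation eline i := (emb t \o line i).

Lemma nonzero_boolP (u : 'I_3 -> zsqrt2) : nonzero_bool u -> nonzero (emb t \o u).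
Proof. by move=> /or3P[] u0; eexists; rewrite /= emb_eq0; exact: u0. Qed.

Lemma eline_det3 i j k : collinear i j k -> det3 (eline i) (eline j) (eline k) = 0.
Proof. by move=> /eqP c; rewrite -det3_rmorph c rmorph0. Qed.

Lemma plan_step known s : (forall i, i \in known -> proportional (eline i) (N i)) ->
  step_ok known s -> proportional (eline s.2) (N s.2).
Proof.
case: s => [[[i j] [k l]] m] kn /and5P[/and5P[ki kj kk kl _] lt ij kl'].
move=> /and4P[cij ckl nm nc].
apply: (@join_step i j k l m (eline i) (eline j) (eline k) (eline l)) => //;
  try by [apply: kn | apply: eline_det3].
  exact: nonzero_boolP.
have [x nx] := nonzero_boolP nc; exists x; apply: contraNneq nx => <-.
rewrite cross_rmorph; apply/eqP.
by move: x; apply: forall_ord3; rewrite /cross /= !rmorphB !rmorphM.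
Qed.

Lemma plan_run known p : (forall i, i \in known -> proportional (eline i) (N i)) ->
  plan_ok known p ->
  forall i, i \in known ++ [seq s.2 | s <- p] -> proportional (eline i) (N i).
Proof.
elim: p known => [|s p IH] known kn /=; first by rewrite cats0 => _; exact: kn.
move=> /andP[sok pok] i; rewrite mem_cat in_cons orbCA -mem_cat => hi.
apply: (IH (s.2 :: known)) => // j.
by rewrite in_cons => /predU1P[->|/kn //]; exact: plan_step sok.
Qed.

End Plan.

Lemma realization (t : sqrt2 K) :
  (forall i, i \in frame -> proportional (emb t \o line i) (N i)) ->
  exists t' : sqrt2 K, forall i, (i < 33)%N -> proportional (emb t' \o line i) (N i).
Proof.
move=> Hframe; have known := plan_run Hframe rational_plan_ok.
have vec3E (a b c : zsqrt2) (u v w : K) i (w' := N i) :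
    emb t a = u -> emb t b = v -> emb t c = w ->
    proportional (emb t \o vec3 a b c) w' -> proportional (vec3 u v w) w'.
  move=> <- <- <- [x x0 e]; exists x => // k; rewrite e; congr (_ * _).
  by move: k; apply: forall_ord3.
have [e0 e1] := (rmorph0 (emb t), rmorph1 (emb t)).
have eN1 : emb t (-1) = -1 by rewrite rmorphN1.
have p0 : proportional (vec3 0 0 1) (N 0) by apply: (vec3E 0 0 1) => //; apply: known.
have p1 : proportional (vec3 1 0 0) (N 1) by apply: (vec3E 1 0 0) => //; apply: known.
have p2 : proportional (vec3 0 1 0) (N 2) by apply: (vec3E 0 1 0) => //; apply: known.
have p4 : proportional (vec3 1 (-1) 0) (N 4)
  by apply: (vec3E 1 (-1) 0) => //; apply: known.
have p15 : proportional (vec3 1 1 (-1)) (N 15)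
  by apply: (vec3E 1 1 (-1)) => //; apply: known.
have p16 : proportional (vec3 1 (-1) (-1)) (N 16)
  by apply: (vec3E 1 (-1) (-1)) => //; apply: known.
have N13_1 : N 13 o1 = 0.
  have /eqP : det3 (N 0) (N 1) (N 13) == 0 by rewrite N_det3.
  move/eqP; rewrite (det3_proportional p0 p1 (proportional_refl _)) => /eqP.
  by move=> d0; rewrite -[RHS]d0 /det3 /vec3 /=; ring.
have N13_0 : N 13 o0 != 0.
  have : det3 (N 0) (N 2) (N 13) != 0 by rewrite N_det3.
  rewrite (det3_proportional p0 p2 (proportional_refl _)).
  by apply: contra_neq => z; rewrite /det3 /vec3 /= z; ring.
pose s := - N 13 o2 / N 13 o0.
have p13 : proportional (vec3 1 0 (- s)) (N 13).
  exists (N 13 o0) => //; apply: forall_ord3; rewrite /vec3 /= ?mulr1 ?mulr0 //.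
  by rewrite /s mulNr opprK mulrC divfK.
have p14 : proportional (vec3 0 1 (- s)) (N 14).
  apply: (join_step (i := 0) (j := 2) (k := 13) (l := 4) _ _ _ _ _ p0 p2 p13 p4) => //.
  - by exists o1; rewrite /vec3 /= oner_eq0.
  - by rewrite /det3 /vec3 /=; ring.
  - by rewrite /det3 /vec3 /=; ring.
  by exists o1; rewrite /cross /vec3 /= (_ : _ - _ = -1) ?oppr_eq0 ?oner_eq0 //; ring.
have p6 : proportional (vec3 (1 - s) (- s) 0) (N 6).
  apply: (join_step (i := 1) (j := 2) (k := 13) (l := 15) _ _ _ _ _ p1 p2 p13 p15) => //.
  (* The value [s = 0] is not excluded yet, so the nonzero coordinate depends on the case. *)
  - have [s0|s0] := eqVneq s 0; last by exists o1; rewrite /vec3 /= oppr_eq0.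
    by exists o0; rewrite /vec3 /= s0 subr0 oner_eq0.
  - by rewrite /det3 /vec3 /=; ring.
  - by rewrite /det3 /vec3 /=; ring.
  have [s0|s0] := eqVneq s 0.
    exists o0; rewrite /cross /vec3 /= (_ : _ - _ = s - 1); last by ring.
    by rewrite s0 sub0r oppr_eq0 oner_eq0.
  by exists o1; rewrite /cross /vec3 /= (_ : _ - _ = s) //; ring.
have s2 : 2 * (s * s) = 1.
  have : det3 (N 14) (N 16) (N 6) == 0 by rewrite N_det3.
  rewrite (det3_proportional p14 p16 p6) => /eqP d0; apply/eqP; rewrite -subr_eq0 -d0.
  by apply/eqP; rewrite /det3 /vec3 /=; ring.
(* The lines [r2 x = 1] and [x = s] agree when the root of 2 is [1 / s = 2 s]. *)
have t2 : (2 * s) * (2 * s) = 2.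
  by have -> : (2 * s) * (2 * s) = 2 * (2 * (s * s)) :> K; [ring|rewrite s2 mulr1].
exists (Sqrt2 t2).
have s0 : 2 * s != 0.
  by apply/eqP => e; move/eqP: s2; rewrite mulrA e mul0r eq_sym oner_eq0.
have base i : i \in 13%N :: frame -> proportional (emb (Sqrt2 t2) \o line i) (N i).
  rewrite in_cons => /predU1P[->|iF].
    apply: proportional_trans p13; apply: proportional_sym.
    exists (2 * s) => //; apply: forall_ord3; rewrite /vec3 /= ?rmorph0 ?rmorphN ?rmorph1.
    - by rewrite /emb /= rmorph0 rmorph1 add0r mul1r mulr1.
    - by rewrite mulr0.
    by rewrite mulrN -mulrA s2.
  (* The frame has integer coefficients, so it does not change with the root. *)
  apply: proportional_trans (Hframe i iF); exists 1; rewrite ?oner_eq0 // => k.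
  rewrite mul1r /=; move: iF; rewrite /frame !in_cons in_nil orbF => /or4P[] /eqP ->;
    by move: k; apply: forall_ord3; rewrite /vec3 /= ?rmorph0 ?rmorphN ?rmorph1.
move=> i i33; apply: (plan_run base full_plan_ok).
by have /allP := full_plan_complete; apply; rewrite mem_iota.
Qed.

End Realization.

(** * Projective frames and transformations *)

Section Frame.
Variable K : fieldType.
Implicit Types (a b c d : 'rV[K]_3) (g : 'M[K]_3).

Definition mat3 a b c : 'M[K]_3 := \matrix_(i, j) vec3 a b c i 0 j.

Lemma mat3_unit a b c : det3 (a 0) (b 0) (c 0) != 0 -> mat3 a b c \in unitmx.
Proof.
move=> d0; pose B : 'M[K]_3 := \matrix_(i, j)
  (vec3 (cross (b 0) (c 0) i) (cross (c 0) (a 0) i) (cross (a 0) (b 0) i) j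
   / det3 (a 0) (b 0) (c 0)).
suff /mulmx1_unit [] : mat3 a b c *m B = 1%:M by [].
apply/matrixP; apply: forall_ord3; apply: forall_ord3;
  rewrite !mxE sum_ord3 !mxE /vec3 /cross /= ?mulr1n ?mulr0n;
  by move: d0; rewrite /det3 => d0; field.
Qed.

Lemma row_mat3 a b c i : row i (mat3 a b c) = vec3 a b c i.
Proof. by apply/rowP => j; rewrite !mxE. Qed.

Lemma frame_map a b c d a' b' c' d' :
  det3 (a 0) (b 0) (c 0) != 0 -> det3 (d 0) (b 0) (c 0) != 0 ->
  det3 (a 0) (d 0) (c 0) != 0 -> det3 (a 0) (b 0) (d 0) != 0 ->
  det3 (a' 0) (b' 0) (c' 0) != 0 -> det3 (d' 0) (b' 0) (c' 0) != 0 ->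
  det3 (a' 0) (d' 0) (c' 0) != 0 -> det3 (a' 0) (b' 0) (d' 0) != 0 ->
  exists2 g : 'M[K]_3, g \in unitmx &
    [/\ proportional ((a *m g) 0) (a' 0), proportional ((b *m g) 0) (b' 0),
        proportional ((c *m g) 0) (c' 0) & proportional ((d *m g) 0) (d' 0)].
Proof.
set D := det3 (a 0) (b 0) (c 0); set Da := det3 (d 0) (b 0) (c 0).
set Db := det3 (a 0) (d 0) (c 0); set Dc := det3 (a 0) (b 0) (d 0).
set D' := det3 (a' 0) (b' 0) (c' 0); set Da' := det3 (d' 0) (b' 0) (c' 0).
set Db' := det3 (a' 0) (d' 0) (c' 0); set Dc' := det3 (a' 0) (b' 0) (d' 0).
move=> D0 Da0 Db0 Dc0 D0' Da0' Db0' Dc0'.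
have uA := mat3_unit D0; have uA' := mat3_unit D0'.
(* These scalings carry the Cramer relation of [a], [b], [c], [d] to that of [a'], [b'], [c'],
   [d']. *)
pose x : 'rV[K]_3 := \row_k vec3 (Da' / Da) (Db' / Db) (Dc' / Dc) k.
have ux : diag_mx x \in unitmx.
  rewrite unitmxE det_diag unitfE; apply/prodf_neq0 => i _; rewrite mxE.
  by move: i; apply: forall_ord3; rewrite /vec3 /= mulf_neq0 ?invr_eq0.
pose g := invmx (mat3 a b c) *m diag_mx x *m mat3 a' b' c'.
have rg i : vec3 a b c i *m g = x 0 i *: vec3 a' b' c' i.
  rewrite -!row_mat3 -row_mul /g !mulmxA mulmxV // mul1mx.
  by apply/rowP => j; rewrite mxE mul_diag_mx !mxE.
have xE i : x 0 i = vec3 (Da' / Da) (Db' / Db) (Dc' / Dc) i by rewrite mxE.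
have ag : a *m g = (Da' / Da) *: a' by rewrite (rg o0) xE.
have bg : b *m g = (Db' / Db) *: b' by rewrite (rg o1) xE.
have cg : c *m g = (Dc' / Dc) *: c' by rewrite (rg o2) xE.
have dg : D *: (d *m g) = D' *: d'.
  have eD : D *: d = Da *: a + Db *: b + Dc *: c.
    by apply/rowP => k; rewrite !mxE; apply: cramer3r.
  have eD' : D' *: d' = Da' *: a' + Db' *: b' + Dc' *: c'.
    by apply/rowP => k; rewrite !mxE; apply: cramer3r.
  rewrite scalemxAl eD eD' !mulmxDl -!scalemxAl ag bg cg !scalerA.
  have VK (y z : K) : z != 0 -> z * (y / z) = y by move=> z0; rewrite mulrC divfK.
  by rewrite !VK.
exists g; first by rewrite !unitmx_mul unitmx_inv uA ux uA'.
have prop (u v : 'rV[K]_3) (y z : K) : y != 0 -> z != 0 -> y *: u = z *: v ->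
    proportional (u 0) (v 0).
  move=> y0 z0 e; exists (z^-1 * y) => [|k]; first by rewrite mulf_neq0 ?invr_eq0.
  have /rowP/(_ k) := e; rewrite !mxE => ek.
  by rewrite -mulrA ek mulrA mulVf // mul1r.
split.
- by apply: (prop _ _ 1 (Da' / Da)); rewrite ?oner_eq0 ?mulf_neq0 ?invr_eq0 ?scale1r.
- by apply: (prop _ _ 1 (Db' / Db)); rewrite ?oner_eq0 ?mulf_neq0 ?invr_eq0 ?scale1r.
- by apply: (prop _ _ 1 (Dc' / Dc)); rewrite ?oner_eq0 ?mulf_neq0 ?invr_eq0 ?scale1r.
exact: (prop _ _ D D').
Qed.

End Frame.

Section Transform.
Variables (K : fieldType) (n : nat) (M : arrangement K n) (g : 'M[K]_3).
Hypotheses (arrM : is_arrangement M) (ug : g \in unitmx).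

Definition transform : arrangement K n := [ffun i => M i *m g].

Lemma transform_is_arrangement : is_arrangement transform.
Proof.
have [M0 Mij] := arrM; split=> [i|i j c ij]; rewrite !ffunE.
  by apply: contraNneq (M0 i) => e; rewrite -[M i](mulmxK ug) e mul0mx.
rewrite scalemxAl; apply: contra_neq (Mij i j c ij).
exact: (can_inj (mulmxK ug)).
Qed.

Lemma on_lineM (L : arrangement K n) i (p : 'rV[K]_3) :
  on_line L i p = ((L i *m p^T) == 0).
Proof.
rewrite /on_line; apply/eqP/eqP => e.
  by apply/rowP => j; rewrite ord1 !mxE -[RHS]e; apply: eq_bigr => k _; rewrite mxE.
have /rowP/(_ 0) := e; rewrite !mxE => {}e; rewrite -[RHS]e.
by apply: eq_bigr => k _; rewrite mxE.
Qed.

(** Lines transform by [g], hence points by its inverse transpose. *)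
Lemma transform_same_lattice : same_lattice M transform.
Proof.
move=> S; split=> [[p [p0 Hp]]|[p [p0 Hp]]].
  exists (p *m (invmx g)^T); split=> [|i iS].
    apply: contraNneq p0 => e.
    have ug' : (invmx g)^T \in unitmx by rewrite unitmx_tr unitmx_inv.
    by rewrite -[p](mulmxK ug') e mul0mx.
  rewrite on_lineM ffunE trmx_mul trmxK -mulmxA [g *m _]mulmxA mulmxV // mul1mx.
  by rewrite -on_lineM Hp.
exists (p *m g^T); split=> [|i iS].
  apply: contraNneq p0 => e; have ug' : g^T \in unitmx by rewrite unitmx_tr.
  by rewrite -[p](mulmxK ug') e mul0mx.
by rewrite on_lineM trmx_mul trmxK mulmxA; have := Hp i iS; rewrite on_lineM ffunE.
Qed.

End Transform.

(** * Realizations of the intersection lattice *)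

Section Rigidity.
Variables (K : numFieldType) (t : sqrt2 K).
Local Notation L := (octagonal t).

Lemma same_lattice_det3 (M : arrangement K 33) : is_arrangement M -> same_lattice L M ->
  forall i j k, i != j -> (det3 (M i 0) (M j 0) (M k 0) == 0) = collinear i j k.
Proof.
move=> arrM lat i j k ij; rewrite -(octagonal_det3 t).
have eM := concurrent3 arrM k ij.
have eL := concurrent3 (octagonal_is_arrangement t) k ij.
by apply/eqP/eqP => e; [apply/eL/lat/eM|apply/eM/lat/eL].
Qed.

Lemma octagonal_realizations (M : arrangement K 33) :
  is_arrangement M -> same_lattice L M ->
  exists t' : sqrt2 K, proj_equiv (octagonal t') M.
Proof.
move=> arrM lat; have detM := same_lattice_det3 arrM lat.
have arrL := octagonal_is_arrangement t.
have detL := @octagonal_det3 K t.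
pose o i : 'I_33 := inord i.
have oE i : (i < 33)%N -> val (o i) = i by exact: inordK.
have [] := @frame_map K (L (o 11%N)) (L (o 12%N)) (L (o 15%N)) (L (o 16%N))
  (M (o 11%N)) (M (o 12%N)) (M (o 15%N)) (M (o 16%N));
  rewrite ?detM ?detL -?val_eqE /= ?oE //.
move=> g ug [p11 p12 p15 p16].
(* With the frame of [M] moved onto that of [L], only the choice of a root remains. *)
pose N := transform M (invmx g).
have ug' : invmx g \in unitmx by rewrite unitmx_inv.
have arrN : is_arrangement N by exact: transform_is_arrangement.
have latN : same_lattice L N.
  by move=> S; apply: iff_trans (lat S) (transform_same_lattice M ug' S).
have detN := same_lattice_det3 arrN latN.
have propN (u : 'rV[K]_3) i : proportional ((u *m g) 0) (M i 0) ->
    proportional (u 0) (N i 0).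
  move=> [c c0 e]; exists c => // k.
  have -> : N i = c *: u; last by rewrite mxE.
  rewrite ffunE (_ : M i = (c *: u) *m g) ?mulmxK //.
  by apply/rowP => j; rewrite e -scalemxAl [RHS]mxE.
have rowL i : (i < 33)%N -> emb t \o line i =1 L (o i) 0.
  by move=> i33 k; rewrite octagonalE oE.
have [//|i j k i33 j33 k33 ij|i|t' Ht'] := @realization K (fun i => N (o i) 0) _ _ t.
- by move=> i i33; apply: row_nonzero; apply: arrN.1.
- by rewrite detN ?oE // -val_eqE /= !oE.
- rewrite /frame !in_cons in_nil orbF => /or4P[] /eqP ->;
    by apply: (@proportional_trans K (L (o _) 0));
      [exists 1; rewrite ?oner_eq0 // => k; rewrite mul1r -rowL|apply: propN].
exists t', g; split=> //.
have /fin_all_exists2 [c c0 ec] (i : 'I_33) :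
    exists2 c : K, c != 0 & N i = c *: octagonal t' i.
  have [c c0 e] := Ht' i (ltn_ord i); exists c => //; apply/rowP => k.
  by rewrite mxE octagonalE -e /o inord_val.
exists c; split=> // i.
by rewrite scalemxAl -ec ffunE mulmxKV.
Qed.

End Rigidity.

Lemma sqrt2_unique (K : numFieldType) (t t' : sqrt2 K) :
  root2 t' = root2 t \/ root2 t' = - root2 t.
Proof.
have : (root2 t' - root2 t) * (root2 t' + root2 t) = 0.
  by have -> : (root2 t' - root2 t) * (root2 t' + root2 t) =
    root2 t' * root2 t' - root2 t * root2 t; [ring|rewrite !root2P subrr].
move/eqP; rewrite mulf_eq0 subr_eq0 addr_eq0 => /orP[] /eqP ->; by [left|right].
Qed.

Lemma eq_octagonal (K : numFieldType) (t t' : sqrt2 K) :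
  root2 t = root2 t' -> octagonal t = octagonal t'.
Proof.
move=> e; apply/ffunP => i; rewrite !ffunE.
by apply/rowP => k; rewrite !mxE /emb e.
Qed.

Lemma opp_sqrt2P (K : numFieldType) (t : sqrt2 K) : - root2 t * - root2 t = 2.
Proof. by rewrite mulrNN root2P. Qed.

Lemma octagonal_rigid (K : numFieldType) (t : sqrt2 K) : rigid (octagonal t).
Proof.
exists [:: octagonal t; octagonal (Sqrt2 (opp_sqrt2P t))] => M arrM lat.
have [t' e] := octagonal_realizations arrM lat; exists (octagonal t') => //.
rewrite !inE; have [e'|e'] := sqrt2_unique t t'.
  by rewrite (eq_octagonal e') eqxx.
by rewrite (eq_octagonal (_ : root2 t' = root2 (Sqrt2 (opp_sqrt2P t)))) ?eqxx ?orbT.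
Qed.

(** * The real arrangement and its complexification *)

Fact real_sqrt2P : Num.sqrt 2 * Num.sqrt 2 = 2 :> RR.
Proof. by rewrite -expr2 sqr_sqrtr ?ler0n. Qed.

Fact complex_sqrt2P : (Num.sqrt 2)%:C%C * (Num.sqrt 2)%:C%C = 2 :> CC.
Proof. by rewrite -rmorphM real_sqrt2P rmorph_nat. Qed.

(** Complexifying replaces the real root by its complex image, so rigidity and freeness proved over
    a general field apply. *)
Lemma complexify_octagonal :
  complexify (octagonal (Sqrt2 real_sqrt2P)) = octagonal (Sqrt2 complex_sqrt2P).
Proof.
apply/ffunP => i; apply/rowP => k; rewrite !ffunE !mxE.
rewrite -[LHS]/((emb _ _)%:C%C) /emb /Zemb rmorphD rmorphM /= !rmorph_int.
by [].
Qed.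

Theorem theoremB :
  exists L : arrangement RR 33,
    is_arrangement L /\
    (nk_eq L 2 108 /\ nk_eq L 3 40 /\ nk_eq L 5 16 /\ nk_eq L 8 5 /\
     (forall k : nat, (2 <= k)%N -> k <> 2%N -> k <> 3%N -> k <> 5%N -> k <> 8%N ->
        nk_eq L k 0)) /\
    rigid (complexify L) /\
    free_with_exponents (defining_poly (complexify L)) 15 17.
Proof.
exists (octagonal (Sqrt2 real_sqrt2P)); rewrite complexify_octagonal.
split; first exact: octagonal_is_arrangement.
split; first exact: octagonal_incidences.
split; first exact: octagonal_rigid.
exact: octagonal_free (octagonal_is_arrangement _).
Qed.
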